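(* Let $\alpha\in(0,2]$. There exist a constant $C(\alpha)>0$ depending only on $\alpha$ and an absolute constant $C>0$ such that the following holds. Let $A\in\mathbb{R}^{m\times n}$ be a random matrix with zero mean whose rows are independent, isotropic, and have $\psi_\alpha$-norm (quasi-norm when $\alpha<1$) uniformly bounded by $K$. Let $T\subset\mathbb{R}^n$ be a bounded set. Then $$\mathbb{E}\sup_{x\in T}\Bigl|\|Ax\|_2-\sqrt{m}\,\|x\|_2\Bigr|\le C(\alpha)K^{4/\alpha}\bigl(\gamma_\alpha(T)+\mathrm{rad}(T)\bigr).$$ Moreover, for any $u\ge0$, with probability at least $1-Ce^{-u^\alpha}$, $$\sup_{x\in T}\Bigl|\|Ax\|_2-\sqrt{m}\,\|x\|_2\Bigr|\le C(\alpha)K^{4/\alpha}\bigl(\gamma_\alpha(T)+u\cdot\mathrm{rad}(T)\bigr).$$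
   Context: For a real random variable $\xi$ and $\alpha>0$, $\|\xi\|_{\psi_\alpha}:=\inf\{t>0:\mathbb{E}\exp(|\xi/t|^\alpha)\le 2\}$. For a random vector $\xi$ in $\mathbb{R}^n$, $\|\xi\|_{\psi_\alpha}:=\sup_{x\in S^{n-1}}\|\langle\xi,x\rangle\|_{\psi_\alpha}$. A random vector $X$ in $\mathbb{R}^n$ is isotropic if $\mathbb{E}XX^\top=I_n$. $\mathrm{rad}(T):=\sup_{t\in T}\|t\|_2$. Talagrand's functional: an admissible sequence of partitions of $T$ is an increasing sequence $(\mathcal{A}_k)_{k\ge0}$ of partitions of $T$ (each $\mathcal{A}_{k+1}$ refines $\mathcal{A}_k$) with $|\mathcal{A}_0|=1$ and $|\mathcal{A}_k|\le 2^{2^k}$ for $k\ge1$. For $t\in T$, $A_k(t)$ is the unique element of $\mathcal{A}_k$ containing $t$. Then $$\gamma_\alpha(T):=\inf\sup_{t\in T}\sum_{k\ge0}2^{k/\alpha}\Delta(A_k(t)),$$ where the infimum is over all admissible sequences and $\Delta(S)=\sup_{s,t\in S}\|s-t\|_2$ is the Euclidean diameter. *)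

(* Defs.v *)
From HB Require Import structures.
From mathcomp Require Export all_boot all_order all_algebra.
From mathcomp Require Export all_classical all_reals all_analysis.
Export Order.TTheory GRing.Theory Num.Theory.
Export numFieldNormedType.Exports.

Set Implicit Arguments.
Unset Strict Implicit.
Unset Printing Implicit Defensive.

Local Open Scope classical_set_scope.
Local Open Scope card_scope.
Local Open Scope ring_scope.

(** Euclidean structure on column vectors; the library's norm [`|x|] on
    matrices is the max norm. *)

Definition dot (R : realType) (n : nat) (x y : 'cV[R]_n) : R :=
  \sum_(i < n) x i 0 * y i 0.

Definition norm2 (R : realType) (n : nat) (x : 'cV[R]_n) : R :=
  Num.sqrt (\sum_(i < n) x i 0 ^+ 2).

(** [rad] and [diam] are suprema in [\bar R], hence [-oo] on the empty set. *)

Definition rad (R : realType) (n : nat) (T : set 'cV[R]_n) : \bar R :=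
  ereal_sup [set (norm2 t)%:E | t in T].

Definition diam (R : realType) (n : nat) (S : set 'cV[R]_n) : \bar R :=
  ereal_sup [set (norm2 (s - t))%:E | s in S & t in S].

(** A set of blocks [F] is a partition of [T] when [partition F id T]: the
    blocks are nonempty, pairwise disjoint, and cover [T]. *)

Definition refines (X : Type) (F G : set (set X)) : Prop :=
  forall S, F S -> exists2 S', G S' & S `<=` S'.

Definition admissible (R : realType) (n : nat) (T : set 'cV[R]_n)
    (F : nat -> set (set 'cV[R]_n)) : Prop :=
  [/\ forall k, partition (F k) id T,
      forall k, refines (F k.+1) (F k),
      F 0%N #= `I_1 &
      forall k, (1 <= k)%N -> F k #<= `I_(2 ^ (2 ^ k))].

Definition gamma (R : realType) (alpha : R) (n : nat) (T : set 'cV[R]_n) :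
    \bar R :=
  ereal_inf [set ereal_sup
      [set \sum_(0 <= k <oo)
             (2 `^ (k%:R / alpha))%:E * diam (pblock (F k) id t) | t in T]%E
    | F in admissible T].

(** The infimum is taken in [\bar R]: it is [+oo] when no [t] qualifies. *)

Definition psi_norm (d : measure_display) (Om : measurableType d)
    (R : realType) (P : probability Om R) (alpha : R) (xi : Om -> R) : \bar R :=
  ereal_inf [set t%:E | t in [set t : R | 0 < t /\
    ('E_P[fun w => expR (`|xi w / t| `^ alpha)%R] <= 2%:E)%E]].

Definition psi_norm_vec (d : measure_display) (Om : measurableType d)
    (R : realType) (P : probability Om R) (alpha : R) (n : nat)
    (X : Om -> 'cV[R]_n) : \bar R :=
  ereal_sup [set psi_norm P alpha (fun w => dot (X w) x)
            | x in [set x : 'cV[R]_n | norm2 x = 1]].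

Definition random_matrix (d : measure_display) (Om : measurableType d)
    (R : realType) (m n : nat) (A : Om -> 'M[R]_(m, n)) : Prop :=
  forall i j, measurable_fun setT (fun w => A w i j).

(** A Lebesgue integral whose positive and negative parts are both infinite
    equals [-oo], so the equations on expectations in [zero_mean] and
    [isotropic] entail integrability. *)

Definition zero_mean (d : measure_display) (Om : measurableType d)
    (R : realType) (P : probability Om R) (m n : nat)
    (A : Om -> 'M[R]_(m, n)) : Prop :=
  forall i j, ('E_P[fun w => A w i j] = 0)%E.

Definition isotropic (d : measure_display) (Om : measurableType d)
    (R : realType) (P : probability Om R) (n : nat) (X : Om -> 'cV[R]_n) :
    Prop :=
  forall i j,
    ('E_P[fun w => ((X w *m (X w)^T) i j)%R] = ((1%:M : 'M[R]_n) i j)%:E)%E.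

Definition borel_set (R : realType) (n : nat) : set (set 'cV[R]_n) :=
  <<s [set U : set 'cV[R]_n | open U] >>.

Definition independent_vectors (d : measure_display) (Om : measurableType d)
    (R : realType) (P : probability Om R) (m n : nat)
    (X : 'I_m -> Om -> 'cV[R]_n) : Prop :=
  forall (J : {set 'I_m}) (B : 'I_m -> set 'cV[R]_n),
    (forall i, i \in J -> borel_set (B i)) ->
    P (\bigcap_(i in [set` J]) X i @^-1` B i)
      = (\prod_(i in J) P (X i @^-1` B i))%E.

Definition matrix_row (Om : Type) (R : realType) (m n : nat)
    (A : Om -> 'M[R]_(m, n)) (i : 'I_m) : Om -> 'cV[R]_n :=
  fun w => (row i (A w))^T.

Definition deviation (R : realType) (m n : nat) (M : 'M[R]_(m, n))
    (T : set 'cV[R]_n) : \bar R :=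
  ereal_sup [set (`|norm2 (M *m x) - Num.sqrt m%:R * norm2 x|)%:E | x in T].

(* Main.v *)
(** The process [Z_x = |Ax| - sqrt m |x|] satisfies
    [P (|Z_x - Z_y| > s B |x - y|) <= 2 exp(-s^alpha)] with
    [B = C(alpha) K^(4/alpha)]. For unit vectors this follows from
    [|Ax| - |Ay| = <A(x-y), A(x+y)> / (|Ax| + |Ay|)] and a tail bound for sums of
    the independent centered variables [<A_i,u><A_i,v> - <u,v>]. These only have
    tails of order [exp(-t^(alpha/2))], hence possibly no exponential moments, so
    they are truncated from above at the level of the deviation before Chernoff's
    method is applied; isotropy bounds [K] from below, which lets powers of [K]
    absorb constants. General vectors reduce to unit ones by homogeneity.

    Generic chaining along an almost optimal admissible sequence, started at the
    level [l] with [2^l] close to [u^alpha], turns the increment bound into the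
    tail of the supremum, and summing the tail over dyadic [u] bounds its
    expectation. *)

Require Import Defs.
From mathcomp Require Import ring lra zify measurable_realfun.

Set Implicit Arguments.
Unset Strict Implicit.
Unset Printing Implicit Defensive.

Local Open Scope classical_set_scope.
Local Open Scope card_scope.
Local Open Scope ring_scope.

(** * Euclidean norm and the deviation of a matrix *)

(** The power [K^(4 / alpha)] comes from the Bernstein bound. Its exponent is [s^alpha / L^4] with
    [L] proportional to [K], where [L^4] is the scale of the second moment of a product of two
    linear forms of a row; keeping this exponent fixed makes [s] grow like [L^(4 / alpha)]. The
    obstacle is the cost of truncation: the event that one of [m] summands exceeds the level must
    have probability of order [exp(-s^alpha)] despite the factor [m]. This is why the level is a
    product [s * r] with [r >= s] and [r >= sqrt m]: then [(s * r)^(alpha/2)] dominates both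
    [s^alpha] and [m^(alpha/4)], and the exponential of the latter beats [m]. The choice
    [r = max(sqrt m, s)] serves a single unit vector, [r = sqrt m] a pair of orthogonal ones. Since
    [T] is an arbitrary set, suprema are handled pathwise: for a fixed matrix the deviation is
    Lipschitz, so the countably many chain points determine it. *)

Section Euclidean.
Context {R : realType} {n : nat}.
Implicit Types (x y z : 'cV[R]_n) (a : R).

Lemma dotC x y : dot x y = dot y x.
Proof. by apply: eq_bigr => i _; rewrite mulrC. Qed.

Lemma dotDl x y z : dot (x + y) z = dot x z + dot y z.
Proof. by rewrite /dot -big_split; apply: eq_bigr => i _; rewrite mxE mulrDl. Qed.

Lemma dotZl a x y : dot (a *: x) y = a * dot x y.
Proof. by rewrite /dot mulr_sumr; apply: eq_bigr => i _; rewrite mxE mulrA. Qed.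

Lemma dotDr x y z : dot x (y + z) = dot x y + dot x z.
Proof. by rewrite dotC dotDl !(dotC x). Qed.

Lemma dotZr a x y : dot x (a *: y) = a * dot x y.
Proof. by rewrite dotC dotZl dotC. Qed.

Lemma dotNl x y : dot (- x) y = - dot x y.
Proof. by rewrite -scaleN1r dotZl mulN1r. Qed.

Lemma dotNr x y : dot x (- y) = - dot x y.
Proof. by rewrite dotC dotNl dotC. Qed.

Lemma norm2_sqr x : norm2 x ^+ 2 = dot x x.
Proof.
rewrite /norm2 sqr_sqrtr; last by apply: sumr_ge0 => i _; exact: sqr_ge0.
by apply: eq_bigr => i _; rewrite expr2.
Qed.

Lemma norm2_ge0 x : 0 <= norm2 x.
Proof. exact: sqrtr_ge0. Qed.

Lemma norm2_sqrt_dot x : norm2 x = Num.sqrt (dot x x).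
Proof. by rewrite -norm2_sqr sqrtr_sqr ger0_norm ?norm2_ge0. Qed.

Lemma norm2Z a x : norm2 (a *: x) = `|a| * norm2 x.
Proof.
by rewrite !norm2_sqrt_dot dotZl dotZr mulrA -expr2 sqrtrM ?sqr_ge0// sqrtr_sqr.
Qed.

Lemma norm2N x : norm2 (- x) = norm2 x.
Proof. by rewrite -scaleN1r norm2Z normrN1 mul1r. Qed.

Lemma norm2B x y : norm2 (x - y) = norm2 (y - x).
Proof. by rewrite -norm2N opprB. Qed.

Lemma norm2_0 : norm2 (0 : 'cV[R]_n) = 0.
Proof. by rewrite -(scale0r 0) norm2Z normr0 mul0r. Qed.


Lemma norm2_eq0 x : (norm2 x == 0) = (x == 0).
Proof.
apply/idP/eqP => [|->]; last by rewrite norm2_0.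
rewrite sqrtr_eq0 => x0; apply/colP => i; rewrite mxE; apply/eqP.
rewrite -sqrf_eq0 eq_le sqr_ge0 andbT (le_trans _ x0)//.
rewrite (bigD1 i)//= lerDl; apply: sumr_ge0 => j _; exact: sqr_ge0.
Qed.

Lemma cauchy_schwarz x y : `|dot x y| <= norm2 x * norm2 y.
Proof.
have [->|y0] := eqVneq y 0.
  by rewrite norm2_0 mulr0 -(scale0r 0) dotZr mul0r normr0.
have ny : 0 < norm2 y ^+ 2 by rewrite exprn_gt0// lt_def norm2_ge0 norm2_eq0 y0.
rewrite -(@ler_pXn2r _ 2)// ?nnegrE ?mulr_ge0 ?norm2_ge0// real_normK ?num_real//.
have := sqr_ge0 (norm2 (norm2 y ^+ 2 *: x - dot x y *: y)).
rewrite [X in 0 <= X]norm2_sqr dotDl !dotDr !dotNl !dotNr !dotZl !dotZr (dotC y x).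
rewrite -!norm2_sqr exprMn.
set d := dot x y; set b := norm2 y ^+ 2; set c := norm2 x ^+ 2 => H.
have: 0 <= b * (c * b - d ^+ 2) by move: H; rewrite !expr2; lra.
by rewrite pmulr_rge0// subr_ge0.
Qed.

Lemma norm2D x y : norm2 (x + y) <= norm2 x + norm2 y.
Proof.
rewrite -(@ler_pXn2r _ 2)// ?nnegrE ?addr_ge0 ?norm2_ge0//.
rewrite norm2_sqr dotDl !dotDr sqrrD !norm2_sqr (dotC y x).
have := le_trans (ler_norm _) (cauchy_schwarz x y); lra.
Qed.

Lemma norm2_dist x y : `|norm2 x - norm2 y| <= norm2 (x - y).
Proof.
have H (u v : 'cV[R]_n) : norm2 u <= norm2 (u - v) + norm2 v.
  by have := norm2D (u - v) v; rewrite subrK.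
rewrite ler_norml; have := H x y; have := H y x; rewrite (norm2B y x); lra.
Qed.

Lemma norm2_triangle x y z : norm2 (x - z) <= norm2 (x - y) + norm2 (y - z).
Proof. by rewrite (le_trans _ (norm2D _ _))// addrA subrK. Qed.

Lemma norm2_normalize x : x != 0 -> norm2 ((norm2 x)^-1 *: x) = 1.
Proof.
by move=> x0; rewrite norm2Z normfV ger0_norm ?norm2_ge0// mulVf ?norm2_eq0.
Qed.

End Euclidean.

Section MatrixNorm.
Context {R : realType} {m n : nat}.
Implicit Types (M : 'M[R]_(m, n)) (x y : 'cV[R]_n).

Lemma mulmx_dot_row M x i : (M *m x) i 0 = dot (row i M)^T x.
Proof. by rewrite mxE; apply: eq_bigr => j _; rewrite !mxE. Qed.

Lemma norm2_mulmx M x :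
  norm2 (M *m x) <= Num.sqrt (\sum_i norm2 (row i M)^T ^+ 2) * norm2 x.
Proof.
rewrite -[X in _ * X](ger0_norm (norm2_ge0 x)) -sqrtr_sqr -sqrtrM; last first.
  by apply: sumr_ge0 => i _; exact: sqr_ge0.
rewrite ler_wsqrtr// mulr_suml ler_sum// => i _.
rewrite mulmx_dot_row -exprMn -real_normK ?num_real//.
by rewrite lerXn2r ?nnegrE ?mulr_ge0 ?norm2_ge0// cauchy_schwarz.
Qed.

Definition dev M x : R := norm2 (M *m x) - Num.sqrt m%:R * norm2 x.

Lemma dev0 M : dev M 0 = 0.
Proof. by rewrite /dev mulmx0 !norm2_0 mulr0 subrr. Qed.

Lemma devZ M a x : dev M (a *: x) = `|a| * dev M x.
Proof. by rewrite /dev -scalemxAr !norm2Z mulrBr; congr (_ - _); ring. Qed.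

(** The constant is the Frobenius norm plus [Num.sqrt m%:R], so it depends on the realization. It
    lets countably many points control the supremum over [T] and bounds each realization on a set of
    finite radius. *)
Lemma dev_lip M : exists2 l, 0 <= l & forall x y, `|dev M x - dev M y| <= l * norm2 (x - y).
Proof.
exists (Num.sqrt (\sum_i norm2 (row i M)^T ^+ 2) + Num.sqrt m%:R).
  by rewrite addr_ge0 ?sqrtr_ge0.
move=> x y; rewrite /dev.
have := norm2_dist (M *m x) (M *m y).
have := norm2_mulmx M (x - y); rewrite mulmxBr mulrDl => h1 h2.
have h3 := le_trans h2 h1.
have h4 : `|Num.sqrt m%:R * norm2 x - Num.sqrt m%:R * norm2 y| <= Num.sqrt m%:R * norm2 (x - y).
  by rewrite -mulrBr normrM ger0_norm ?sqrtr_ge0// ler_wpM2l ?sqrtr_ge0// norm2_dist.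
move: h3 h4; rewrite !ler_norml; lra.
Qed.

End MatrixNorm.

(** * Elementary inequalities for exponentials and powers *)

Section RealBounds.
Context {R : realType}.
Implicit Types x y z p : R.

Lemma powR_le_expR p : 0 < p ->
  exists2 C, 0 < C & forall z, 0 <= z -> z `^ p <= C * expR z.
Proof.
(* The bound is [z / p <= expR (z / p)] raised to the power [p]. *)
move=> p0; exists (p `^ p); first exact: powR_gt0.
move=> z z0.
have -> : z = p * (z / p) by field; rewrite gt_eqF.
have zp : 0 <= z / p by rewrite divr_ge0// ltW.
rewrite powRM ?(ltW p0)// ler_wpM2l ?powR_ge0//.
have -> : expR (p * (z / p)) = expR (z / p) `^ p by rewrite -expRM mulrC.
rewrite ge0_ler_powR ?nnegrE ?expR_ge0 ?(ltW p0)//.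
by rewrite (le_trans _ (expR_ge1Dx _))// lerDr.
Qed.

(** A Taylor bound whose remainder has no exponential factor for negative [x], as a truncation from
    above alone requires. *)
Lemma expR_quadratic x : expR x <= 1 + x + x ^+ 2 * expR (Num.max x 0).
Proof.
have [x0|x0] := leP 0 x; last first.
  rewrite expR0 mulr1.
  rewrite -[x]opprK expRN -[leLHS]mul1r ler_pdivrMr ?expR_gt0//.
  have h := expR_ge1Dx (- x).
  apply: (@le_trans _ _ ((1 + - - x + (- - x) ^+ 2) * (1 - x))); last first.
    by rewrite ler_wpM2l//; nra.
  rewrite opprK (_ : _ * _ = 1 - x ^+ 3); last by ring.
  by rewrite exprS; nra.
have [x1|x1] := leP 1 x.
  rewrite -[leLHS]mul1r (@le_trans _ _ (x ^+ 2 * expR x))//.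
    by rewrite ler_wpM2r ?expR_ge0// expr_ge1.
  by rewrite lerDr addr_ge0.
have h := expR_ge1Dx (- x).
have h2 : expR x * (1 - x) <= 1.
  by rewrite -ler_pdivlMl ?expR_gt0// mulr1 -expRN.
have e0 := expR_gt0 x.
nra.
Qed.


(** For [0 < y <= M] write [y = y^(alpha/2) * y^(1 - alpha/2)]: the second factor is at most
    [M^(1 - alpha/2)], which [lam] compensates, and the first is at most [2 + 2 * U^alpha]. Hence
    [lam * y] costs at most half of [(U / L)^alpha] plus a constant, and the other half pays for
    [Y ^+ 2]. *)
Lemma mgf_pointwise alpha : 0 < alpha -> alpha <= 2 ->
  exists2 C : R, 0 < C & forall L U Y M lam : R, 1 <= L -> 0 <= U -> 0 <= M ->
    0 <= lam -> `|Y| <= U ^+ 2 + 1 ->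
    lam * M `^ (1 - alpha / 2) <= L ^- 4 / 4 ->
    expR (lam * Num.min Y M) <=
      1 + lam * Y + lam ^+ 2 * (C * L ^+ 4 * expR ((U / L) `^ alpha)).
Proof.
move=> a0 a2.
have p0 : 0 < 4 / alpha by rewrite divr_gt0.
have [C C0 HC] := powR_le_expR p0.
set D := C * 2 `^ (4 / alpha).
have D0 : 0 < D by rewrite mulr_gt0 ?powR_gt0.
exists (2 * (D + 1) * expR (1/2)); first by rewrite !mulr_gt0 ?expR_gt0 ?addr_gt0.
move=> L U Y M lam L1 U0 M0 lam0 YU lamM.
have L0 : 0 < L by rewrite (lt_le_trans _ L1).
set y := Num.min Y M; set z := (U / L) `^ alpha.
have z0 : 0 <= z by exact: powR_ge0.
have UL0 : 0 <= U / L by rewrite divr_ge0// ltW.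
have yY : y <= Y by rewrite /y ge_min lexx.
have y2 : y ^+ 2 <= Y ^+ 2.
  rewrite /y; case: (leP Y M) => // MY.
  by rewrite ler_pXn2r// ?nnegrE ?(le_trans M0)// ltW.
have Y2 : Y ^+ 2 <= 2 * (D + 1) * L ^+ 4 * expR (z / 2).
  have h1 : Y ^+ 2 <= 2 * (U ^+ 4 + 1).
    rewrite -real_normK ?num_real//.
    rewrite (@le_trans _ _ ((U ^+ 2 + 1) ^+ 2))//.
      by rewrite ler_pXn2r// nnegrE// (le_trans _ YU).
    rewrite (_ : U ^+ 4 = (U ^+ 2) ^+ 2); last by rewrite -exprM.
    by have := sqr_ge0 (U ^+ 2 - 1); nra.
  have h2 : (U / L) ^+ 4 <= D * expR (z / 2).
    have -> : (U / L) ^+ 4 = (2 * (z / 2)) `^ (4 / alpha).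
      have -> : 2 * (z / 2) = z by field.
      rewrite /z -powRrM (_ : alpha * (4 / alpha) = 4%:R) ?powR_mulrn//.
      by field; rewrite gt_eqF.
    rewrite powRM//; last by rewrite divr_ge0.
    rewrite /D mulrAC mulrC ler_wpM2r ?powR_ge0// HC// divr_ge0//.
  have -> : 2 * (D + 1) * L ^+ 4 * expR (z / 2) =
      2 * (L ^+ 4 * (D * expR (z / 2)) + L ^+ 4 * expR (z / 2)) by ring.
  rewrite (le_trans h1)// ler_wpM2l// lerD//.
    rewrite -ler_pdivrMl ?exprn_gt0//.
    by rewrite mulrC -expr_div_n.
  rewrite -[leLHS]mul1r ler_pM ?exprn_ege1//.
  by rewrite (le_trans _ (expR_ge1Dx _))// lerDl divr_ge0.
have hy : Num.max (lam * y) 0 <= 1/2 + z / 2.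
  have [_|ly] := leP (lam * y) 0; first by rewrite addr_ge0// divr_ge0.
  have y0 : 0 < y by rewrite ltNge; apply/negP => y0; move: ly; rewrite ltNge mulr_ge0_le0.
  have yM : y <= M by rewrite /y ge_min lexx orbT.
  have yU : y <= U ^+ 2 + 1 by rewrite (le_trans yY)// (le_trans (ler_norm _)).
  have e : y = y `^ (alpha / 2) * y `^ (1 - alpha / 2).
    by rewrite -powRD ?(gt_eqF y0) ?implybT// addrC subrK powRr1// ltW.
  have b1 : y `^ (1 - alpha / 2) <= M `^ (1 - alpha / 2).
    by rewrite ge0_ler_powR// ?nnegrE ?(ltW y0)//; lra.
  have b2 : y `^ (alpha / 2) <= 2 + 2 * (U `^ alpha).
    rewrite (@le_trans _ _ ((U ^+ 2 + 1) `^ (alpha / 2)))//.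
      by rewrite ge0_ler_powR// ?nnegrE ?(ltW y0)// ?addr_ge0 ?sqr_ge0//; lra.
    have k2 : 2 `^ (alpha / 2) <= 2 :> R.
      by rewrite -[leRHS]powRr1// ler_powR//; lra.
    have [U1|U1] := leP U 1.
      rewrite (@le_trans _ _ (2 `^ (alpha / 2)))//.
        by rewrite ge0_ler_powR// ?nnegrE ?addr_ge0 ?sqr_ge0//; [lra|nra].
      by rewrite (le_trans k2)// lerDl mulr_ge0 ?powR_ge0.
    rewrite (@le_trans _ _ ((2 * U ^+ 2) `^ (alpha / 2)))//.
      by rewrite ge0_ler_powR// ?nnegrE ?addr_ge0 ?mulr_ge0 ?sqr_ge0//; [lra|nra].
    rewrite powRM ?sqr_ge0// -powR_mulrn// -powRrM (_ : 2 * (alpha / 2) = alpha); last by field.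
    have := powR_ge0 U alpha; nra.
  have b3 : lam * y <= L ^- 4 / 4 * (2 + 2 * U `^ alpha).
    rewrite {1}e mulrCA [leRHS]mulrC ler_pM ?powR_ge0//.
      by rewrite mulr_ge0// powR_ge0.
    by rewrite (le_trans _ lamM)// ler_wpM2l.
  rewrite (le_trans b3)//.
  have l1 : L ^- 4 <= 1 by rewrite invf_le1 ?exprn_gt0// exprn_ege1.
  have l2 : L ^- 4 * U `^ alpha <= z.
    rewrite /z powRM ?invr_ge0 ?(ltW L0)// mulrC ler_wpM2l ?powR_ge0//.
    rewrite -[L^-1]powR_inv1 ?(ltW L0)// -powRrM mulN1r powRN lef_pV2 ?posrE ?powR_gt0 ?exprn_gt0//.
    rewrite -powR_mulrn ?(ltW L0)// ler_powR//; lra.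
  lra.
rewrite (le_trans (expR_quadratic _))// lerD//.
  by rewrite lerD2l ler_wpM2l.
rewrite [(lam * y) ^+ 2]exprMn -[leLHS]mulrA ler_wpM2l ?sqr_ge0//.
apply: (@le_trans _ _ ((2 * (D + 1) * L ^+ 4 * expR (z / 2)) * expR (1/2 + z / 2))).
  by rewrite ler_pM ?sqr_ge0 ?expR_ge0 ?(le_trans y2)// ler_expR.
rewrite expRD [X in _ <= _ * X](_ : expR z = expR (z / 2) * expR (z / 2)); last first.
  by rewrite -expRD; congr expR; field.
by rewrite le_eqVlt; apply/orP; left; apply/eqP; ring.
Qed.

End RealBounds.

(** * Product of independent bounded variables *)

Lemma step_approx {R : realType} (x delta : R) (N : nat) :
  0 <= x -> x <= N%:R * delta -> 0 <= delta ->
  x <= \sum_(j < N) delta * (j%:R * delta < x)%R%:R <= x + delta.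
Proof.
move=> x0 xN d0.
(* Clamping at [N%:R * delta] makes the claim inductive, since [x <= N%:R * delta] is lost for
   smaller [N]. *)
have H : Num.min x (N%:R * delta) <= \sum_(j < N) delta * (j%:R * delta < x)%R%:R
    <= Num.min (x + delta) (N%:R * delta).
  elim: N {xN} => [|N /andP[IH1 IH2]].
    by rewrite big_ord0 mul0r (min_idPr x0) (min_idPr (addr_ge0 x0 d0)) lexx.
  rewrite big_ord_recr/= -natr1 mulrDl mul1r.
  move: IH1 IH2; case: (ltP (N%:R * delta) x) => h; rewrite ?mulr1 ?mulr0 ?addr0.
    rewrite le_min => h1 /andP[h2 h3]; rewrite ge_min le_min.
    by rewrite !lerD2r h1 h3 orbT/= andbT (le_trans h3)// ltW.
  rewrite le_min => h1 /andP[h2 h3]; rewrite ge_min le_min h1 h2/=.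
  by rewrite (le_trans h3) ?lerDl.
by move: H; rewrite (min_idPl xN) le_min => /andP[-> /andP[-> _]].
Qed.

Lemma measurable_gt d (Om : measurableType d) (R : realType) (f : Om -> R) (a : R) :
  measurable_fun setT f -> measurable [set w | a < f w].
Proof.
move=> /(_ measurableT [set` `]a, +oo[] (measurable_itv _)); rewrite setTI.
by congr measurable; apply/seteqP; split => w /=; rewrite in_itv/= andbT.
Qed.

Lemma measurable_expR_powR d (Om : measurableType d) (R : realType)
    (f : Om -> R) (L alpha : R) : measurable_fun setT f ->
  measurable_fun setT (fun w => expR ((f w / L) `^ alpha)).
Proof.
move=> mf; apply: measurableT_comp => //.
apply: (@measurableT_comp _ _ _ _ _ _ (fun y : R => y `^ alpha) _
  (fun w => f w / L)); first exact: measurable_powR.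
exact: measurable_funM.
Qed.

Section ProductOfIndependent.
Context d (Om : measurableType d) (R : realType) (P : probability Om R).

(* Each [f i] is replaced by a step function with step [delta] on its
   superlevel sets, so that only finitely many events are involved and no limit
   has to be taken. *)
Lemma expectation_prod_le m (f : 'I_m -> Om -> R) (b delta : R) (q : 'I_m -> R) :
  (forall i, measurable_fun setT (f i)) ->
  (forall i w, 0 <= f i w <= b) -> 0 < delta ->
  (forall a : 'I_m -> R, P (\bigcap_i [set w | a i < f i w])
     = (\prod_i P [set w | (a i < f i w)%R])%E) ->
  (forall i, \int[P]_w (f i w)%:E <= (q i)%:E)%E ->
  (\int[P]_w (\prod_i f i w)%:E <= (\prod_i (q i + delta))%:E)%E.
Proof.
move=> mf fb d0 ind fq.
have [N bN] : exists N : nat, b <= N%:R * delta.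
  exists (Num.bound `|b / delta|); rewrite -ler_pdivrMr//.
  by rewrite (le_trans (ler_norm _))// ltW// archi_boundP.
pose E i (j : 'I_N) := [set w | j%:R * delta < f i w].
have mE i j : measurable (E i j).
  exact: measurable_gt.
have fE i w : f i w <= \sum_(j < N) delta * \1_(E i j) w <= f i w + delta.
  have /andP[f0 fle] := fb i w.
  have := step_approx f0 (le_trans fle bN) (ltW d0).
  rewrite (eq_bigr (fun j => delta * \1_(E i j) w))// => j _.
  by rewrite indicE /E mem_setE.
pose F i w := \sum_(j < N) delta * \1_(E i j) w.
have F0 i w : 0 <= F i w by apply: sumr_ge0 => j _; rewrite mulr_ge0// ltW.
have mF i j : measurable_fun setT (fun w => delta * \1_(E i j) w : R).
  by apply: measurable_funM => //; exact: measurable_indic.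
pose p i j := fine (P (E i j)).
have intE (A : set Om) : measurable A -> (\int[P]_w (\1_A w)%:E = P A)%E.
  by move=> mA; rewrite integral_indic// setIT.
have Eij i j : (\int[P]_w (delta * \1_(E i j) w)%:E = (delta * p i j)%:E)%E.
  under eq_integral do rewrite EFinM.
  rewrite ge0_integralZl_EFin ?(ltW d0)//; last first.
    by apply/measurable_EFinP; exact: measurable_indic.
  by rewrite intE// EFinM fineK// fin_num_measure.
have Fq i : \sum_(j < N) delta * p i j <= q i + delta.
  rewrite -lee_fin.
  apply: (@le_trans _ _ (\int[P]_w (F i w)%:E)%E).
    under eq_integral do rewrite /F -sumEFin.
    rewrite ge0_integral_sum//; last 2 first.
    - by move=> j; apply/measurable_EFinP.
    - by move=> j w _; rewrite lee_fin mulr_ge0// ltW.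
    by rewrite -sumEFin; apply: lee_sum => j _; rewrite Eij.
  apply: (@le_trans _ _ (\int[P]_w ((f i w)%:E + delta%:E))%E).
    apply: ge0_le_integral => //.
    - by move=> w _; rewrite lee_fin.
    - by apply/measurable_EFinP; exact: measurable_sum.
    - by apply: emeasurable_funD => //; apply/measurable_EFinP.
    - by move=> w _; rewrite -EFinD lee_fin; have /andP[] := fE i w.
  rewrite ge0_integralD//; last 3 first.
  - by move=> w _; rewrite lee_fin; have /andP[] := fb i w.
  - by apply/measurable_EFinP.
  - by move=> w _; rewrite lee_fin ltW.
  by rewrite EFinD leeD// integral_cst//= probability_setT mule1.
apply: (@le_trans _ _ (\int[P]_w (\prod_i F i w)%:E)%E).
  apply: ge0_le_integral => //.
  - by move=> w _; rewrite lee_fin prodr_ge0// => i _; have /andP[] := fb i w.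
  - by apply/measurable_EFinP; exact: measurable_prod.
  - apply/measurable_EFinP; apply: measurable_prod => i _; exact: measurable_sum.
  - move=> w _; rewrite lee_fin ler_prod// => i _.
    by have /andP[-> _] := fb i w; have /andP[] := fE i w.
(* Distributivity turns the product of sums into a sum over all choices [phi] of one threshold per
   factor; each term is an indicator of an intersection, where [ind] applies. The same
   distributivity read backwards reassembles the product. *)
under eq_integral => w _.
  rewrite /F bigA_distr_bigA/=.
  under eq_bigr do rewrite big_split/= prodr_const card_ord.
  rewrite -sumEFin; over.
have cap (phi : {ffun 'I_m -> 'I_N}) w :
    \prod_i \1_(E i (phi i)) w = \1_(\bigcap_i E i (phi i)) w :> R.
  rewrite [RHS]indicE; case: (boolP (w \in _)) => [|/negP h].
    by rewrite inE => h; rewrite big1// => i _; rewrite indicE mem_set//; exact: h.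
  have [i hi] : exists i, ~ E i (phi i) w.
    by apply/existsNP => h'; apply: h; rewrite inE => i _.
  by rewrite (bigD1 i)//= indicE memNset// mul0r.
have mcap (phi : {ffun 'I_m -> 'I_N}) : measurable (\bigcap_i E i (phi i)).
  by apply: fin_bigcap_measurable => //; exact: finite_finset.
rewrite ge0_integral_sum//; last 2 first.
- move=> phi; apply/measurable_EFinP; apply: measurable_funM => //.
  by under eq_fun do rewrite cap; exact: measurable_indic.
- by move=> phi w _; rewrite lee_fin mulr_ge0 ?exprn_ge0 ?(ltW d0)// cap.
rewrite (eq_bigr (fun phi : {ffun 'I_m -> 'I_N} => (\prod_i (delta * p i (phi i)))%:E)).
  rewrite sumEFin -(bigA_distr_bigA (fun i j => delta * p i j)) lee_fin; apply: ler_prod => i _.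
  rewrite Fq andbT sumr_ge0// => j _; rewrite mulr_ge0 ?(ltW d0)//.
  exact: fine_ge0.
move=> phi _; under eq_integral do rewrite cap EFinM.
rewrite ge0_integralZl_EFin ?exprn_ge0 ?(ltW d0)//; last first.
  by apply/measurable_EFinP; exact: measurable_indic.
rewrite intE// (ind (fun i => (phi i)%:R * delta)) big_split/= prodr_const card_ord EFinM.
congr (_ * _)%E; rewrite -prodEFin; apply: eq_bigr => i _.
by rewrite fineK// fin_num_measure.
Qed.

End ProductOfIndependent.

(** * A Bernstein inequality for heavy-tailed summands *)

Section ProbabilityBounds.
Context d (Om : measurableType d) (R : realType) (P : probability Om R).

Lemma prob_le_integral (A : set Om) (f : Om -> R) : measurable A ->
  measurable_fun setT f -> (forall w, 0 <= f w) -> (forall w, A w -> 1 <= f w) ->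
  (P A <= \int[P]_w (f w)%:E)%E.
Proof.
move=> mA mf f0 f1; rewrite -[A in leLHS]setIT -integral_indic//.
apply: ge0_le_integral => //.
- by apply/measurable_EFinP; exact: measurable_indic.
- exact/measurable_EFinP.
- move=> w _; rewrite lee_fin indicE; case: (boolP (w \in A)) => //.
  by rewrite inE => /f1.
Qed.

Lemma prob_le_add (A B D : set Om) (a b : R) : measurable A -> measurable B ->
  measurable D -> D `<=` A `|` B -> (P A <= a%:E)%E -> (P B <= b%:E)%E ->
  (P D <= (a + b)%:E)%E.
Proof.
move=> mA mB mD DAB Pa Pb; rewrite EFinD.
apply: (@le_trans _ _ (P (A `|` B))).
  by apply: le_measure; rewrite ?inE//; exact: measurableU.
by rewrite (le_trans (measureU2 _ _ _))// leeD.
Qed.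

Lemma prob_bigU_le m (B : 'I_m -> set Om) (b : R) : (forall i, measurable (B i)) ->
  (forall i, P (B i) <= b%:E)%E ->
  (P (\big[setU/set0]_(i < m) B i) <= (m%:R * b)%:E)%E.
Proof.
move=> mB Pb; elim: m B mB Pb => [|m IH] B mB Pb.
  by rewrite big_ord0 measure0 mul0r.
rewrite big_ord_recr/= -natr1 mulrDl mul1r.
apply: (prob_le_add _ _ _ (@subset_refl _ _)) => //; last exact: IH.
- exact: bigsetU_measurable.
- by apply: measurableU => //; exact: bigsetU_measurable.
Qed.

(** Since [+oo - +oo] is [-oo], a finite difference of the integrals of the positive and negative
    parts forces both to be finite. *)
Lemma integrable_of_fin_num_integral (f : Om -> R) : measurable_fun setT f ->
  (\int[P]_w (f w)%:E)%E \is a fin_num -> P.-integrable setT (EFin \o f).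
Proof.
move=> mf; have mef : measurable_fun setT (EFin \o f) by exact/measurable_EFinP.
rewrite integralE => h; apply/integrableP; split=> //.
rewrite (eq_integral ((EFin \o f)^\+ \+ (EFin \o f)^\-)%E); last first.
  by move=> w _; rewrite -[LHS]/((abse \o (EFin \o f)) w) fune_abse.
rewrite ge0_integralD//; last 2 first.
- exact: measurable_funepos.
- exact: measurable_funeneg.
move: h; rewrite -/(EFin \o f).
have : (0 <= \int[P]_x (EFin \o f)^\- x)%E by exact: integral_ge0.
have : (0 <= \int[P]_x (EFin \o f)^\+ x)%E by exact: integral_ge0.
case: (integral _ _ _) => [a||]//=; case: (integral _ _ _) => [b||]//= _ _ _.
by rewrite -EFinD ltry.
Qed.

(* Truncating from above only keeps the first-order term at most [lam * Y],
   whose expectation vanishes. *)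
Lemma mgf_truncated_le (Y G : Om -> R) (lam M k : R) :
  measurable_fun setT Y -> measurable_fun setT G ->
  (\int[P]_w (Y w)%:E = 0)%E -> (forall w, 0 <= G w) ->
  (\int[P]_w (G w)%:E <= 4%:E)%E -> 0 <= k ->
  (forall w, expR (lam * Num.min (Y w) M) <= 1 + lam * Y w + k * G w) ->
  (\int[P]_w (expR (lam * Num.min (Y w) M))%:E <= (1 + 4 * k)%:E)%E.
Proof.
move=> mY mG Y0 G0 G4 k0 H.
have iG : P.-integrable setT (EFin \o G).
  apply/integrableP; split; first exact/measurable_EFinP.
  under eq_integral do rewrite /= ger0_norm//.
  by rewrite (le_lt_trans G4)// ltry.
have iY := integrable_of_fin_num_integral mY _ ; rewrite Y0 in iY; have {}iY := iY isT.
have i1 : P.-integrable setT (fun w => (1 + lam * Y w)%:E).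
  rewrite (_ : (fun w => _) = cst 1%:E \+ (fun w => lam%:E * (Y w)%:E))%E//.
  apply: integrableD => //; first exact: finite_measure_integrable_cst.
  exact: integrableZl.
have i2 : P.-integrable setT (fun w => (k * G w)%:E) by exact: (integrableZl measurableT k iG).
apply: (@le_trans _ _ (\int[P]_w ((1 + lam * Y w)%:E + (k * G w)%:E))%E).
  apply: ge0_le_integral => //.
  - apply/measurable_EFinP; apply: measurableT_comp => //.
    by apply: measurable_funM => //; exact: measurable_minr.
  - by apply: emeasurable_funD; [exact: measurable_int i1|exact: measurable_int i2].
  - by move=> w _; rewrite -EFinD lee_fin.
rewrite integralD//.
have -> : (\int[P]_w (1 + lam * Y w)%:E = 1)%E.
  rewrite (eq_integral (cst 1%:E \+ (fun w => lam%:E * (Y w)%:E))%E)//.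
  rewrite integralD//; [|exact: finite_measure_integrable_cst|exact: integrableZl].
  rewrite integralZl// (_ : (\int[P]_x (Y x)%:E = 0)%E)// mule0 adde0.
  by rewrite integral_cst//= probability_setT mule1.
have -> : (\int[P]_w (k * G w)%:E = k%:E * \int[P]_w (G w)%:E)%E.
  by rewrite -(integralZl measurableT iG).
rewrite EFinD leeD2l// EFinM muleC lee_pmul//.
by rewrite integral_ge0// => w _; rewrite lee_fin.
Qed.

End ProbabilityBounds.

Section Bernstein.
Context (R : realType) (alpha : R).
Hypotheses (alpha_gt0 : 0 < alpha) (alpha_le2 : alpha <= 2).

Let powR_sqr (x : R) : 0 <= x -> (x ^+ 2) `^ (alpha / 2) = x `^ alpha.
Proof.
move=> x0; rewrite -powR_mulrn// -powRrM; congr (_ `^ _).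
by rewrite mulrC divfK.
Qed.

Let powR_le_pow4 (L : R) : 1 <= L -> L `^ alpha <= L ^+ 4.
Proof.
move=> L1; rewrite -powR_mulrn ?(le_trans _ L1)// ler_powR//.
by rewrite (le_trans alpha_le2)// ler_nat.
Qed.

(** A summand above [s * r] forces [U ^+ 2 >= s * r / 2]. The quantity [(s * r / L ^+ 2)^(alpha/2)]
    dominates [s^alpha / L ^+ 4] because [r >= s], and [mm^(alpha/4)] because [r ^+ 2 >= mm] and
    [s >= L ^+ 2]. The first part gives the tail, the second pays for a union bound. *)
Lemma envelope_ge (L U Y s r mm : R) : 1 <= L -> 0 <= U -> `|Y| <= U ^+ 2 + 1 ->
  2 * L ^+ 2 <= s -> s <= r -> 0 <= mm -> mm <= r ^+ 2 -> s * r < Y ->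
  (s `^ alpha / L ^+ 4 + mm `^ (alpha / 4)) / 4 <= (U / L) `^ alpha.
Proof.
have a0 := alpha_gt0; have a2 := alpha_le2.
move=> L1 U0 YU Ls sr mm0 mr srY.
have L0 : 0 < L by rewrite (lt_le_trans _ L1).
have LL : 1 <= L ^+ 2 by rewrite exprn_ege1.
have s2 : 2 <= s by lra.
have r0 : 0 < r by lra.
have b0 : 0 < alpha / 2 by rewrite divr_gt0.
have srU : s * r / 2 <= U ^+ 2.
  have := le_trans (ler_norm _) YU.
  have : 4 <= s * r by nra.
  lra.
have -> : (U / L) `^ alpha = (U ^+ 2 / L ^+ 2) `^ (alpha / 2).
  by rewrite -exprVn -exprMn powR_sqr// divr_ge0// ltW.
have h0 : ((s * r / 2) / L ^+ 2) `^ (alpha / 2) <= (U ^+ 2 / L ^+ 2) `^ (alpha / 2).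
  rewrite ge0_ler_powR ?(ltW b0)// ?nnegrE ?divr_ge0 ?mulr_ge0 ?sqr_ge0//; try lra.
  by rewrite ler_wpM2r// invr_ge0 sqr_ge0.
apply: le_trans h0.
have -> : s * r / 2 / L ^+ 2 = (s * r / L ^+ 2) / 2 by ring.
have q0 : 0 <= s * r / L ^+ 2 by rewrite divr_ge0 ?sqr_ge0// mulr_ge0; lra.
set q := (s * r / L ^+ 2) `^ (alpha / 2).
have q1 : q / 2 <= (s * r / L ^+ 2 / 2) `^ (alpha / 2).
  rewrite powRM// ler_wpM2l ?powR_ge0//.
  rewrite -[leLHS]powRr1// ger_powR//; last by lra.
  by apply/andP; split; lra.
have q2 : s `^ alpha / L ^+ 4 <= q.
  apply: (@le_trans _ _ ((s ^+ 2 / L ^+ 2) `^ (alpha / 2))).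
    rewrite powRM ?invr_ge0 ?sqr_ge0// powR_sqr; last lra.
    rewrite ler_wpM2l ?powR_ge0// -[L ^- 2]powR_inv1 ?sqr_ge0// -powRrM mulN1r powRN.
    by rewrite powR_sqr ?(ltW L0)// lef_pV2 ?posrE ?powR_gt0 ?exprn_gt0// powR_le_pow4.
  rewrite ge0_ler_powR ?(ltW b0)// ?nnegrE ?divr_ge0 ?sqr_ge0//.
  by rewrite ler_wpM2r ?invr_ge0 ?sqr_ge0// expr2 ler_wpM2l//; lra.
have q3 : mm `^ (alpha / 4) <= q.
  have -> : mm `^ (alpha / 4) = Num.sqrt mm `^ (alpha / 2).
    rewrite -{1}(sqr_sqrtr mm0) -powR_mulrn ?sqrtr_ge0// -powRrM; congr (_ `^ _).
    by field.
  rewrite ge0_ler_powR ?(ltW b0)// ?nnegrE ?sqrtr_ge0//.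
  apply: (@le_trans _ _ r).
    by rewrite -[leRHS]gtr0_norm// -sqrtr_sqr ler_wsqrtr.
  rewrite mulrAC -[leLHS]mul1r ler_wpM2r ?(ltW r0)// ler_pdivlMr ?exprn_gt0//; lra.
lra.
Qed.

(* The witness is the Chernoff parameter [c s^(alpha-1) / (L^4 r)]: small enough
   for the truncation level [s r] in [mgf_pointwise], and such that the variance
   term is at most half of the exponent [lam s r]. *)
Lemma lambda_bounds (c L s r : R) : 0 < c -> c <= 4^-1 -> 1 <= L -> 1 <= s -> s <= r ->
  exists lam : R,
  [/\ 0 < lam, lam * (s * r) `^ (1 - alpha / 2) <= L ^- 4 / 4,
      lam * (s * r) = c * (s `^ alpha / L ^+ 4) &
      forall C mm : R, 0 < C -> 0 <= mm -> mm <= r ^+ 2 -> c <= (16 * C)^-1 ->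
        16 * C * lam * L ^+ 4 * mm <= s * r].
Proof.
have a0 := alpha_gt0; have a2 := alpha_le2.
move=> c0 c4 L1 s1 sr; pose lam := c * s `^ (alpha - 1) / (L ^+ 4 * r); exists lam.
have L0 : 0 < L by rewrite (lt_le_trans _ L1).
have L40 : 0 < L ^+ 4 by rewrite exprn_gt0.
have s0 : 0 < s by lra.
have r0 : 0 < r by lra.
have S0 x : 0 < s `^ x by exact: powR_gt0.
split.
- by rewrite /lam divr_gt0 ?mulr_gt0.
- have -> : lam * (s * r) `^ (1 - alpha / 2) =
      c * L ^- 4 * (s `^ (alpha - 1) * (s * r) `^ (1 - alpha / 2) / r).
    by rewrite /lam; field; rewrite !gt_eqF.
  rewrite mulrC [c * _]mulrC mulrCA -[leRHS]mulr1 -[leRHS]mulrA ler_wpM2l ?invr_ge0 ?(ltW L40)//.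
  rewrite mulrC ler_pM//; first by rewrite ltW.
    by rewrite divr_ge0 ?(ltW r0)// mulr_ge0 ?powR_ge0.
  rewrite ler_pdivrMr// mul1r powRM ?(ltW s0) ?(ltW r0)// mulrA -powRD ?(gt_eqF s0) ?implybT//.
  have -> : alpha - 1 + (1 - alpha / 2) = alpha / 2 by field.
  rewrite -[leRHS]powRr1 ?(ltW r0)//.
  rewrite [X in _ <= _ `^ X](_ : 1 = alpha / 2 + (1 - alpha / 2)); last by ring.
  rewrite [leRHS]powRD ?(gt_eqF r0) ?implybT// ler_wpM2r ?powR_ge0//.
  by rewrite ge0_ler_powR ?nnegrE ?(ltW s0) ?(ltW r0)// divr_ge0// ltW.
- rewrite /lam; have -> : s `^ alpha = s * s `^ (alpha - 1).
    by rewrite -{2}[s]powRr1 ?(ltW s0)// -powRD ?(gt_eqF s0) ?implybT//; congr (_ `^ _); ring.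
  by field; rewrite !gt_eqF.
- move=> C mm C0 mm0 mr cC.
  have -> : 16 * C * lam * L ^+ 4 * mm = (16 * C * c) * (s `^ (alpha - 1) * (mm / r)).
    by rewrite /lam; field; rewrite !gt_eqF.
  rewrite -[leRHS]mul1r ler_pM ?mulr_ge0 ?powR_ge0 ?invr_ge0 ?(ltW c0) ?(ltW C0) ?(ltW r0)//.
    by rewrite mulrC -ler_pdivlMr ?mulr_gt0// div1r.
  rewrite ler_pM ?powR_ge0 ?divr_ge0 ?(ltW r0)//.
    by rewrite -[leRHS]powRr1 ?(ltW s0)// ler_powR//; lra.
  by rewrite ler_pdivrMr// -expr2.
Qed.


(* [U i] is an envelope for the [i]-th summand, which is quadratic in a
   psi_alpha variable. With [s <= r] and [m <= r^2] the bound covers both the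
   regime [r = sqrt m] and the regime [r = s]. *)
Lemma bernstein : exists c C : R, [/\ 0 < c, 0 < C &
  forall d (Om : measurableType d) (P : probability Om R) m (L s r : R)
    (Y U : 'I_m -> Om -> R),
  1 <= L -> 0 <= s -> s <= r -> m%:R <= r ^+ 2 ->
  (forall i, measurable_fun setT (Y i)) ->
  (forall i, measurable_fun setT (U i)) ->
  (forall i w, 0 <= U i w) ->
  (forall i w, `|Y i w| <= U i w ^+ 2 + 1) ->
  (forall i, \int[P]_w (expR ((U i w / L) `^ alpha))%:E <= 4%:E)%E ->
  (forall i, \int[P]_w (Y i w)%:E = 0)%E ->
  (forall B : 'I_m -> set R, (forall i, open (B i)) ->
    P (\bigcap_i Y i @^-1` B i) = \prod_i P (Y i @^-1` B i))%E ->
  (P [set w | (s * r < \sum_i Y i w)%R]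
    <= (C * expR (- (c * (s `^ alpha / L ^+ 4))))%:E)%E].
Proof.
have a0 := alpha_gt0; have a2 := alpha_le2.
have [C1 C10 HC1] := mgf_pointwise alpha_gt0 alpha_le2.
have [C2 C20 HC2] := @powR_le_expR R (4 / alpha) (divr_gt0 (ltr0n _ 4) alpha_gt0).
(* [4^-1] serves the truncation condition of [mgf_pointwise]; [(16 * C1)^-1] keeps the variance term
   below half of the Chernoff exponent. *)
pose c0 := Num.min 4^-1 (16 * C1)^-1.
have c00 : 0 < c0 by rewrite /c0 lt_min !invr_gt0 ltr0n mulr_gt0.
have c04 : c0 <= 4^-1 by rewrite /c0 ge_min lexx.
have c0C : c0 <= (16 * C1)^-1 by rewrite /c0 ge_min lexx orbT.
pose D := 4 * (4 `^ (4 / alpha) * C2).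
have D0 : 0 < D by rewrite !mulr_gt0// powR_gt0.
(* Half of the Chernoff exponent survives the variance term. In the prefactor, [1] comes from the
   truncated sum, [D] from the union bound over large summands, and [expR (2 * c0)] from the range
   [s < 2 * L ^+ 2], where [x <= 4]. *)
exists (c0 / 2), (1 + D + expR (2 * c0)); split.
- by rewrite divr_gt0.
- by rewrite !addr_gt0// expR_gt0.
move=> d Om P m L s r Y U L1 s0 sr mr mY mU U0 YU EU EY ind.
have L0 : 0 < L by rewrite (lt_le_trans _ L1).
have LL : 1 <= L ^+ 2 by rewrite exprn_ege1.
set x := s `^ alpha / L ^+ 4.
have x0 : 0 <= x by rewrite divr_ge0 ?powR_ge0// exprn_ge0// ltW.
have mS : measurable_fun setT (fun w => \sum_i Y i w) by exact: measurable_sum.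
(* For small [s] the right-hand side exceeds 1. *)
have [sL|sL] := ltP s (2 * L ^+ 2).
  rewrite (le_trans (probability_le1 _ _))//; first exact: measurable_gt.
  have x4 : x <= 4.
    rewrite ler_pdivrMr ?exprn_gt0//.
    apply: (@le_trans _ _ ((2 * L ^+ 2) `^ alpha)).
      rewrite ge0_ler_powR ?(ltW alpha_gt0)// ?nnegrE ?(ltW sL)//.
      by rewrite mulr_ge0 ?sqr_ge0.
    apply: (@le_trans _ _ ((2 * L ^+ 2) `^ 2%:R)); first by rewrite ler_powR//; lra.
    rewrite powR_mulrn; last by rewrite mulr_ge0 ?sqr_ge0.
    by rewrite exprMn -exprM ler_wpM2r ?exprn_ge0 ?(ltW L0)//; lra.
  rewrite lee_fin (@le_trans _ _ (expR (2 * c0) * expR (- (c0 / 2 * x))))//.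
    by rewrite -expRD -[leLHS]expR0 ler_expR subr_ge0; nra.
  by rewrite ler_wpM2r ?expR_ge0// lerDr addr_ge0// ltW.
have s1 : 1 <= s by lra.
have r0 : 0 < r by lra.
have [lam [l0 lM lt lC]] := lambda_bounds c00 c04 L1 s1 sr.
set M := s * r in lM lt lC *.
have M0 : 0 <= M by rewrite mulr_ge0// ltW.
pose k := lam ^+ 2 * (C1 * L ^+ 4).
have k0 : 0 < k by rewrite /k !mulr_gt0 ?exprn_gt0.
pose f i w := expR (lam * Num.min (Y i w) M).
have mf i : measurable_fun setT (f i).
  apply: measurableT_comp => //.
  by apply: measurable_funM => //; exact: measurable_minr.
have mG i : measurable_fun setT (fun w => expR ((U i w / L) `^ alpha)).
  exact: measurable_expR_powR.
have Ef i : (\int[P]_w (f i w)%:E <= (1 + 4 * k)%:E)%E.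
  apply: (mgf_truncated_le (mY i) (mG i)) => //; first exact: ltW.
  move=> w; rewrite (le_trans (HC1 _ _ _ _ _ L1 (U0 i w) M0 (ltW l0) (YU i w) lM))//.
  by rewrite /k !mulrA.
(* One [4 * k] is the moment bound; the other is the discretization step [delta], which merely
   doubles the variance term. *)
have Eprod : (\int[P]_w (\prod_i f i w)%:E <= (\prod_(i < m) (1 + 4 * k + 4 * k))%:E)%E.
  apply: (@expectation_prod_le _ _ _ _ _ _ (expR (lam * M))) => //.
  - move=> i w; rewrite expR_ge0/= ler_expR ler_pM2l// ge_min lexx orbT//.
  - by rewrite mulr_gt0.
  - move=> a; pose B i := [set y : R | a i < expR (lam * Num.min y M)].
    have oB i : open (B i).
      rewrite (_ : B i = (fun y => expR (lam * Num.min y M)) @^-1` [set y | a i < y])//.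
      apply: open_comp; last exact: open_gt.
      move=> y _; apply: continuous_comp; last exact: continuous_expR.
      apply: cvgM; first exact: cvg_cst.
      by apply: (@continuous_min R R id (cst M)) => //; exact: cvg_cst.
    exact: (ind B oB).
have Etail : (P [set w | (M < \sum_i Num.min (Y i w) M)%R]
    <= (expR (- (c0 / 2 * x)))%:E)%E.
  pose g w := expR (- (lam * M)) * \prod_i f i w.
  have mg : measurable_fun setT (fun w => \prod_i f i w) by exact: measurable_prod.
  have f0 w : 0 <= \prod_i f i w by apply: prodr_ge0 => i _; exact: expR_ge0.
  apply: (@le_trans _ _ (\int[P]_w (g w)%:E)%E).
    apply: prob_le_integral => //.
    - by apply: measurable_gt; apply: measurable_sum => i; exact: measurable_minr.
    - exact: measurable_funM.
    - by move=> w; rewrite mulr_ge0 ?expR_ge0.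
    - move=> w /= Mw; rewrite /g /f -expR_sum -expRD -[leLHS]expR0 ler_expR -mulr_sumr.
      by rewrite addrC subr_ge0 ler_pM2l// ltW.
  rewrite /g; under eq_integral do rewrite EFinM.
  rewrite ge0_integralZl_EFin ?expR_ge0//; last 2 first.
  - by move=> w _; rewrite lee_fin.
  - exact/measurable_EFinP.
  apply: (@le_trans _ _ ((expR (- (lam * M)))%:E * (\prod_(i < m) (1 + 4 * k + 4 * k))%:E)%E).
    by rewrite lee_pmul2l// lte_fin expR_gt0.
  rewrite -EFinM lee_fin prodr_const card_ord.
  have h : (1 + 4 * k + 4 * k) ^+ m <= expR (8 * k * m%:R).
    rewrite expRM_natr lerXn2r ?nnegrE ?expR_ge0//; first by rewrite !addr_ge0// mulr_ge0// ltW.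
    by rewrite (le_trans _ (expR_ge1Dx _))//; lra.
  rewrite (@le_trans _ _ (expR (- (lam * M)) * expR (8 * k * m%:R)))//.
    by rewrite ler_wpM2l ?expR_ge0.
  rewrite -expRD ler_expR.
  have := lC C1 m%:R C10 (ler0n _ _) mr c0C.
  rewrite -(ler_pM2l l0) lt -/x => h2.
  have : 8 * k * m%:R = 2^-1 * (lam * (16 * C1 * lam * L ^+ 4 * m%:R)).
    by rewrite /k; field.
  by move=> ->; lra.
pose a := (x + m%:R `^ (alpha / 4)) / 4.
have PY i : (P [set w | (M < Y i w)%R] <= (4 * expR (- a))%:E)%E.
  apply: (@le_trans _ _ (\int[P]_w (expR (- a) * expR ((U i w / L) `^ alpha))%:E)%E).
    apply: prob_le_integral => //.
    - exact: measurable_gt.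
    - exact: measurable_funM.
    - move=> w /= MY; rewrite -expRD -[leLHS]expR0 ler_expR addrC subr_ge0.
      exact: (envelope_ge L1 (U0 i w) (YU i w) sL sr (ler0n _ _) mr MY).
  under eq_integral do rewrite EFinM.
  rewrite ge0_integralZl_EFin ?expR_ge0//; last exact/measurable_EFinP.
  by rewrite EFinM muleC lee_wpmul2r// lee_fin expR_ge0.
have m4 : m%:R * (4 * expR (- a)) <= D * expR (- (c0 / 2 * x)).
  pose z := m%:R `^ (alpha / 4) / 4 : R.
  have z0 : 0 <= z by rewrite divr_ge0 ?powR_ge0.
  have mz : m%:R <= 4 `^ (4 / alpha) * C2 * expR z.
    have {1}-> : m%:R = (4 * z) `^ (4 / alpha).
      rewrite /z (_ : 4 * (_ / 4) = m%:R `^ (alpha / 4)); last by field.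
      rewrite -powRrM (_ : alpha / 4 * (4 / alpha) = 1) ?powRr1//.
      by field; rewrite gt_eqF.
    by rewrite powRM// -mulrA ler_wpM2l ?powR_ge0// HC2.
  have -> : - a = - z - x / 4 by rewrite /a /z; field.
  apply: (@le_trans _ _ (4 `^ (4 / alpha) * C2 * expR z * (4 * expR (- z - x / 4)))).
    by rewrite ler_wpM2r// mulr_ge0 ?expR_ge0.
  have -> : 4 `^ (4 / alpha) * C2 * expR z * (4 * expR (- z - x / 4)) =
      D * (expR z * expR (- z - x / 4)).
    by rewrite /D; ring.
  rewrite ler_pM2l// -expRD ler_expR.
  have : c0 * x <= 4^-1 * x by rewrite ler_wpM2r.
  by move: x0; lra.
apply: (@le_trans _ _ (expR (- (c0 / 2 * x)) + D * expR (- (c0 / 2 * x)))%:E); last first.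
  rewrite lee_fin [leRHS]mulrDl mulrDl mul1r lerDl mulr_ge0 ?expR_ge0//.
(* If no summand exceeds [M], truncation changes nothing. *)
apply: (@prob_le_add _ _ _ _ [set w | M < \sum_i Num.min (Y i w) M]
  (\big[setU/set0]_(i < m) [set w | M < Y i w])) => //.
- by apply: measurable_gt; apply: measurable_sum => i; exact: measurable_minr.
- by apply: bigsetU_measurable => i _; exact: measurable_gt.
- exact: measurable_gt.
- move=> w /= MS; have [[i hi]|h] := pselect (exists i, M < Y i w).
    by right; rewrite -bigcup_seq; exists i => //=; rewrite mem_index_enum.
  left; rewrite (lt_le_trans MS)// ler_sum// => i _.
  rewrite le_min lexx/= leNgt; apply/negP => hi; apply: h; by exists i.
- apply: (@le_trans _ _ (m%:R * (4 * expR (- a)))%:E); last by rewrite lee_fin.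
  by apply: prob_bigU_le => // i; exact: measurable_gt.
Qed.

End Bernstein.

(** * Quadratic forms of a random matrix and increments *)

Lemma measurable_sqrt (R : realType) : measurable_fun setT (@Num.sqrt R).
Proof. by apply: nondecreasing_measurable => // x y *; exact: ler_wsqrtr. Qed.

Lemma continuous_dot (R : realType) n (u : 'cV[R]_n) : continuous (fun x => dot x u).
Proof.
rewrite /dot; elim: (index_enum _) => [|i s IH].
  under eq_fun do rewrite big_nil.
  exact: cst_continuous.
under eq_fun do rewrite big_cons.
have ci : continuous (fun x : 'cV[R]_n => x i 0) by exact: coord_continuous.
by move=> x; apply: continuousD (IH x); apply: continuousM (ci x) _; exact: cst_continuous.
Qed.

(** Preimages of open sets are then open, so independence of the rows passes to the scalar
    summands. *)
Lemma continuous_dot_dot (R : realType) n (u v : 'cV[R]_n) (sg c : R) :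
  continuous (fun x => sg * (dot x u * dot x v - c)).
Proof.
have cu := @continuous_dot _ _ u; have cv := @continuous_dot _ _ v.
have cuv : continuous (fun x => dot x u * dot x v).
  by move=> x; exact: (continuousM (cu x) (cv x)).
move=> x; apply: (@continuousM _ _ (cst sg) (fun x => dot x u * dot x v - c)).
  exact: cst_continuous.
apply: (@continuousB _ R^o _ (fun x => dot x u * dot x v) (cst c)); first exact: cuv.
exact: cst_continuous.
Qed.

Section RandomMatrix.
Context d (Om : measurableType d) (R : realType) (P : probability Om R).
Context (m n : nat) (A : Om -> 'M[R]_(m, n)).
Hypothesis mA : random_matrix A.

Lemma measurable_dot_row i u : measurable_fun setT (fun w => dot (matrix_row A i w) u).
Proof.
apply: measurable_sum => j; apply: measurable_funM => //.
by under eq_fun do rewrite !mxE; exact: mA.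
Qed.

Lemma measurable_norm2_mulmx x : measurable_fun setT (fun w => norm2 (A w *m x)).
Proof.
apply: (measurableT_comp (@measurable_sqrt R)).
apply: measurable_sum => i; apply: measurable_funX.
by under eq_fun do rewrite mulmx_dot_row; exact: measurable_dot_row.
Qed.

Lemma measurable_dot_mulmx x y :
  measurable_fun setT (fun w => dot (A w *m x) (A w *m y)).
Proof.
apply: measurable_sum => i; apply: measurable_funM => //;
  by under eq_fun do rewrite mulmx_dot_row; exact: measurable_dot_row.
Qed.

Lemma measurable_dev x : measurable_fun setT (fun w => dev (A w) x).
Proof. by apply: measurable_funB => //; exact: measurable_norm2_mulmx. Qed.

(** Isotropy prescribes finite expectations, so products of coordinates are integrable and both
    claims follow by bilinear expansion. *)
Lemma expectation_dot_row i u v : isotropic P (matrix_row A i) ->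
  P.-integrable setT (fun w => (dot (matrix_row A i w) u * dot (matrix_row A i w) v)%:E) /\
  (\int[P]_w (dot (matrix_row A i w) u * dot (matrix_row A i w) v)%:E = (dot u v)%:E)%E.
Proof.
move=> iso.
pose X := matrix_row A i.
have mX a : measurable_fun setT (fun w => X w a 0).
  by under eq_fun do rewrite !mxE; exact: mA.
have EX a b : (\int[P]_w (X w a 0 * X w b 0)%:E = ((a == b)%:R)%:E)%E.
  have := iso a b; rewrite unlock mxE => <-; apply: eq_integral => w _.
  by congr EFin; rewrite [RHS]mxE big_ord1; congr (_ * _); rewrite [RHS]mxE.
have iX a b : P.-integrable setT (fun w => (X w a 0 * X w b 0)%:E).
  apply: integrable_of_fin_num_integral; first exact: measurable_funM.
  by rewrite EX.
have E w : ((dot (X w) u * dot (X w) v)%:E =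
    \sum_a \sum_b ((u a 0 * v b 0)%:E * (X w a 0 * X w b 0)%:E))%E.
  rewrite /dot mulr_suml -sumEFin; apply: eq_bigr => a _.
  rewrite mulr_sumr -sumEFin; apply: eq_bigr => b _.
  by rewrite -EFinM; congr EFin; ring.
rewrite -/X; split.
  rewrite (_ : (fun w => _) =
    fun w => (\sum_a \sum_b ((u a 0 * v b 0)%:E * (X w a 0 * X w b 0)%:E))%E); last first.
    by apply/funext => w; exact: E.
  apply: integrable_sum => // a _; apply: integrable_sum => // b _.
  exact: integrableZl.
under eq_integral do rewrite E.
rewrite integral_sum//; last first.
  by move=> a; apply: integrable_sum => // b _; exact: integrableZl.
rewrite /dot -sumEFin; apply: eq_bigr => a _.
rewrite integral_sum//; last by move=> b; exact: integrableZl.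
rewrite (bigD1 a)//= integralZl// EX eqxx mule1 big1 ?adde0// => b ba.
by rewrite integralZl// EX eq_sym (negbTE ba) mule0.
Qed.

End RandomMatrix.

Section DeviationOfUnitVectors.
Context (R : realType).

(** With [N] the norm of the image and [g = Num.sqrt m%:R], factor [N ^+ 2 - g ^+ 2] as
    [(N - g) * (N + g)]: the sum is at least [g], and at least [|N - g|], which exceeds [s]. The
    maximum becomes the parameter [r] of the Bernstein bound. *)
Lemma dev_unit_sub m n (M : 'M[R]_(m, n)) (u : 'cV[R]_n) (s : R) :
  norm2 u = 1 -> 0 <= s -> s < `|dev M u| ->
  s * Num.max (Num.sqrt m%:R) s < `|dot (M *m u) (M *m u) - m%:R * dot u u|.
Proof.
move=> u1 s0; rewrite -!norm2_sqr u1 expr1n mulr1 /dev u1 mulr1.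
set N := norm2 _; set g := Num.sqrt m%:R => sN.
have N0 : 0 <= N by exact: norm2_ge0.
have g0 : 0 <= g by exact: sqrtr_ge0.
rewrite -[m%:R in ltRHS](@sqr_sqrtr R m%:R) ?ler0n// -/g.
rewrite subr_sqr normrM (ger0_norm (addr_ge0 N0 g0)).
have h : `|N - g| <= N + g by rewrite (le_trans (ler_normB _ _))// !ger0_norm.
have r1 : Num.max g s <= N + g by rewrite ge_max lerDr N0/= (le_trans _ h)// ltW.
rewrite (@le_lt_trans _ _ (s * (N + g)))//; first by rewrite ler_wpM2l.
by rewrite ltr_pM2r//; lra.
Qed.

(** For large [s] the reverse triangle inequality makes the image of the direction of [x - y] longer
    than [s], hence its deviation large. Otherwise either the norm of [M *m x] is off by [s / 4], or
    it is at least half of [Num.sqrt m%:R], which bounds from below the denominator in the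
    difference of norms. The subtracted scalar product is 0, [x - y] and [x + y] being orthogonal;
    it matches the centered quadratic form. *)
Lemma norm2_unit_sub m n (M : 'M[R]_(m, n)) (x y : 'cV[R]_n) (s : R) :
  norm2 x = 1 -> norm2 y = 1 -> x != y -> 0 <= s ->
  s * norm2 (x - y) < `|norm2 (M *m x) - norm2 (M *m y)| ->
  if 2 * Num.sqrt m%:R <= s then
    (s / 4 < `|dev M ((norm2 (x - y))^-1 *: (x - y))| : Prop)
  else x + y != 0 /\ (s / 4 < `|dev M x| \/
    s / 4 * Num.sqrt m%:R <
      `|dot (M *m ((norm2 (x - y))^-1 *: (x - y))) (M *m ((norm2 (x + y))^-1 *: (x + y)))
        - m%:R * dot ((norm2 (x - y))^-1 *: (x - y)) ((norm2 (x + y))^-1 *: (x + y))|).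
Proof.
move=> x1 y1 xy s0 H; set D := norm2 (x - y) in H *.
have xy0 : x - y != 0 by rewrite subr_eq0.
have D0 : 0 < D by rewrite lt_def norm2_eq0 xy0 norm2_ge0.
set u := D^-1 *: (x - y).
have u1 : norm2 u = 1 by exact: norm2_normalize.
have Du : x - y = D *: u by rewrite /u scalerA mulfV ?scale1r// gt_eqF.
have g0 : 0 <= Num.sqrt m%:R :> R by exact: sqrtr_ge0.
case: ifP => [gs|/negbT]; [|rewrite -ltNge => gs].
  have : s * D < D * norm2 (M *m u).
    rewrite (lt_le_trans H)// (le_trans (norm2_dist _ _))//.
    by rewrite -mulmxBr Du -scalemxAr norm2Z gtr0_norm.
  rewrite mulrC ltr_pM2l// => sN.
  rewrite /dev u1 mulr1 (lt_le_trans _ (ler_norm _))//; lra.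
have [xy1|xy1] := eqVneq (x + y) 0.
  move: H; rewrite -(addrK y x) xy1 sub0r mulmxN norm2N subrr normr0 ltNge.
  by rewrite mulr_ge0 ?norm2_ge0.
split=> //; set E := norm2 (x + y).
have E0 : 0 < E by rewrite lt_def norm2_eq0 xy1 norm2_ge0.
have E2 : E <= 2 by rewrite (le_trans (norm2D _ _))// x1 y1.
set v := E^-1 *: (x + y).
have Ev : x + y = E *: v by rewrite /v scalerA mulfV ?scale1r// gt_eqF.
have uv : dot u v = 0.
  rewrite /u /v dotZl dotZr dotDl !dotDr !dotNl -!norm2_sqr x1 y1 (dotC y x).
  by ring.
rewrite uv mulr0 subr0.
have [|dx] := ltP (s / 4) `|dev M x|; [by left|right].
set a := norm2 (M *m x) in H; set b := norm2 (M *m y) in H.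
have b0 : 0 <= b by exact: norm2_ge0.
have ga : Num.sqrt m%:R / 2 <= a.
  by move: dx; rewrite /dev x1 mulr1 -/a ler_norml => /andP[]; lra.
have e : `|a - b| * (a + b) = D * E * `|dot (M *m u) (M *m v)|.
  have ab0 : 0 <= a + b by rewrite addr_ge0// norm2_ge0.
  rewrite -[X in _ * X](ger0_norm ab0) -normrM -subr_sqr !norm2_sqr.
  rewrite (_ : _ - _ = dot (M *m (x - y)) (M *m (x + y))); last first.
    rewrite mulmxBr mulmxDr dotDl !dotDr !dotNl (dotC (M *m y) (M *m x)); ring.
  rewrite Du Ev -(scalemxAr D M u) -(scalemxAr E M v) dotZl dotZr !normrM.
  rewrite (gtr0_norm D0) (gtr0_norm E0).
  by rewrite mulrA.
set t := `|dot _ _| in e *.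
have t0 : 0 <= t by exact: normr_ge0.
have h1 : s * D * (a + b) < `|a - b| * (a + b) by rewrite ltr_pM2r//; lra.
have h2 : D * E * t <= D * 2 * t by rewrite ler_wpM2r// ler_wpM2l// ltW.
have h3 : s * D * (Num.sqrt m%:R / 2) <= s * D * (a + b).
  by rewrite ler_wpM2l ?mulr_ge0 ?(ltW D0)//; lra.
have : D * (s * Num.sqrt m%:R / 2) < D * (2 * t) by lra.
by rewrite ltr_pM2l//; lra.
Qed.

(** With [a <= b] the two norms, the difference equals [a * (|M x'| - |M y'|) - (b - a) * dev M y'],
    where [b - a] is at most [norm2 (x - y)] and [a * norm2 (x' - y')] at most twice that. Were both
    alternatives false, the total would be at most three quarters of [s * norm2 (x - y)]. *)
Lemma dev_sub m n (M : 'M[R]_(m, n)) (x y : 'cV[R]_n) (s : R) :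
  x != 0 -> norm2 x <= norm2 y -> 0 <= s ->
  let x' := (norm2 x)^-1 *: x in let y' := (norm2 y)^-1 *: y in
  s * norm2 (x - y) < `|dev M x - dev M y| ->
  s / 4 * norm2 (x' - y') < `|norm2 (M *m x') - norm2 (M *m y')| \/ s / 4 < `|dev M y'|.
Proof.
move=> x0 xy s0 x' y' H.
set a := norm2 x in xy *; set b := norm2 y in xy *.
have a0 : 0 < a by rewrite lt_def norm2_eq0 x0 norm2_ge0.
have b0 : 0 < b by rewrite (lt_le_trans a0).
have y0 : y != 0 by rewrite -norm2_eq0 gt_eqF.
have x1 : norm2 x' = 1 by exact: norm2_normalize.
have y1 : norm2 y' = 1 by exact: norm2_normalize.
have ex : x = a *: x' by rewrite scalerA mulfV ?scale1r// gt_eqF.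
have ey : y = b *: y' by rewrite scalerA mulfV ?scale1r// gt_eqF.
set D := norm2 (x - y) in H.
have abD : b - a <= D.
  by rewrite (le_trans (ler_norm _))// (le_trans (norm2_dist _ _))// norm2B.
have h1 : a * norm2 (x' - y') <= 2 * D.
  rewrite -[a]gtr0_norm// -norm2Z scalerBr -ex (le_trans (norm2_triangle x y _))//.
  rewrite {2}ey -scalerBl norm2Z y1 mulr1 ger0_norm ?subr_ge0//.
  by rewrite -/D; lra.
have e : dev M x - dev M y = a * (norm2 (M *m x') - norm2 (M *m y')) - (b - a) * dev M y'.
  rewrite {1}ex {1}ey (devZ M a x') (devZ M b y') !gtr0_norm// /dev x1 y1; ring.
have [|h2] := ltP (s / 4 * norm2 (x' - y')) `|norm2 (M *m x') - norm2 (M *m y')|.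
  by left.
right; rewrite ltNge; apply/negP => h3.
move: H; rewrite e ltNge => /negP; apply.
rewrite (le_trans (ler_normB _ _))// !normrM (gtr0_norm a0).
rewrite (ger0_norm (_ : 0 <= b - a)) ?subr_ge0//.
set p := `|norm2 _ - _| in h2 *; set q := `|dev _ _| in h3 *; set dd := norm2 (x' - y') in h1 h2.
have D0 : 0 <= D by exact: norm2_ge0.
have q0 : 0 <= q by exact: normr_ge0.
have k1 : a * p <= a * (s / 4 * dd) by rewrite ler_wpM2l// ltW.
have k2 : (b - a) * q <= D * (s / 4) by rewrite ler_pM ?subr_ge0.
have k3 : s / 4 * (a * dd) <= s / 4 * (2 * D) by rewrite ler_wpM2l// divr_ge0.
have k4 : 0 <= s * D by rewrite mulr_ge0.
lra.
Qed.

(** The lower bound on [K] needs a row and a unit vector to test it on; matrices lacking either are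
    treated by this identity. *)
Lemma dev_trivial m n (M : 'M[R]_(m, n)) x : (m == 0)%N || (n == 0)%N -> dev M x = 0.
Proof.
case/orP => /eqP e.
  move: M; rewrite e => M; rewrite /dev sqrtr0 mul0r subr0.
  apply/eqP; rewrite norm2_eq0; apply/eqP.
  by apply/colP => -[].
suff -> : x = 0 by exact: dev0.
by move: x; rewrite e => x; apply/colP => -[].
Qed.

End DeviationOfUnitVectors.

Section Increments.
Context (R : realType) (alpha : R).
Hypotheses (alpha_gt0 : 0 < alpha) (alpha_le2 : alpha <= 2).

(** The Bernstein bound is applied to the centered products and to their negatives, whence [C + C].
    The envelope is the larger of the two linear forms; the exponential of a maximum is at most the
    sum of the exponentials, whence the moment [4 = 2 + 2]. *)
Lemma quadratic_form_tail : exists c C : R, [/\ 0 < c, 0 < C &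
  forall d (Om : measurableType d) (P : probability Om R) m n (A : Om -> 'M[R]_(m, n))
    (L s r : R) (u v : 'cV[R]_n),
  random_matrix A -> independent_vectors P (matrix_row A) ->
  (forall i, isotropic P (matrix_row A i)) -> 1 <= L ->
  (forall i x, norm2 x = 1 ->
    (\int[P]_w (expR ((`|dot (matrix_row A i w) x| / L) `^ alpha))%:E <= 2%:E)%E) ->
  0 <= s -> s <= r -> m%:R <= r ^+ 2 -> norm2 u = 1 -> norm2 v = 1 ->
  (P [set w | (s * r < `|dot (A w *m u) (A w *m v) - m%:R * dot u v|)%R]
    <= (C * expR (- (c * (s `^ alpha / L ^+ 4))))%:E)%E].
Proof.
have [c [C [c0 C0 H]]] := bernstein alpha_gt0 alpha_le2.
exists c, (C + C); split=> //; first by rewrite addr_gt0.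
move=> d Om P m n A L s r u v mA ind iso L1 psi s0 sr mr u1 v1.
have L0 : 0 < L by rewrite (lt_le_trans _ L1).
pose X := matrix_row A.
pose U i w := Num.max `|dot (X i w) u| `|dot (X i w) v|.
pose Y (sg : R) i w := sg * (dot (X i w) u * dot (X i w) v - dot u v).
have mX i x : measurable_fun setT (fun w => dot (X i w) x) by exact: measurable_dot_row.
have mXn i x : measurable_fun setT (fun w => `|dot (X i w) x|).
  by apply: measurableT_comp => //; exact: mX.
have mU i : measurable_fun setT (U i) by exact: measurable_maxr.
have mY sg i : measurable_fun setT (Y sg i).
  by apply: measurable_funM => //; apply: measurable_funB => //; exact: measurable_funM.
have U0 i w : 0 <= U i w by rewrite /U le_max normr_ge0.
have uv1 : `|dot u v| <= 1.
  by rewrite (le_trans (cauchy_schwarz _ _))// u1 v1 mulr1.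
have YU sg i w : `|sg| = 1 -> `|Y sg i w| <= U i w ^+ 2 + 1.
  move=> sg1; rewrite normrM sg1 mul1r (le_trans (ler_normB _ _))// lerD//.
  by rewrite normrM expr2 ler_pM ?normr_ge0// /U le_max lexx ?orbT.
have mE i x : measurable_fun setT (fun w => expR ((`|dot (X i w) x| / L) `^ alpha)).
  exact: measurable_expR_powR.
have EU i : (\int[P]_w (expR ((U i w / L) `^ alpha))%:E <= 4%:E)%E.
  apply: (@le_trans _ _ (\int[P]_w ((expR ((`|dot (X i w) u| / L) `^ alpha))%:E +
     (expR ((`|dot (X i w) v| / L) `^ alpha))%:E))%E).
    apply: ge0_le_integral => //.
    - by apply/measurable_EFinP; exact: measurable_expR_powR.
    - by apply: emeasurable_funD; exact/measurable_EFinP.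
    - move=> w _; rewrite -EFinD lee_fin /U.
      by rewrite /Num.max; case: ifP => _; [rewrite lerDr|rewrite lerDl]; exact: expR_ge0.
  rewrite ge0_integralD//; [|exact/measurable_EFinP..].
  rewrite (_ : 4%:E = 2%:E + 2%:E)%E; last by rewrite -EFinD; congr EFin; ring.
  by rewrite leeD// psi.
have EY sg i : (\int[P]_w (Y sg i w)%:E = 0)%E.
  have [iX EX] := expectation_dot_row mA u v (iso i).
  under eq_integral do rewrite EFinM.
  have ic := finite_measure_integrable_cst P (dot u v) measurableT.
  rewrite integralZl//; last exact: (integrableB measurableT iX ic).
  rewrite (integralB_EFin measurableT iX ic).
  have -> : (\int[P]_x (cst (dot u v) x)%:E = (dot u v)%:E)%E.
    by rewrite -[RHS]mule1 -(probability_setT P) -integral_cst.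
  by rewrite EX subee// mule0.
have iY sg (B : 'I_m -> set R) : (forall i, open (B i)) ->
    (P (\bigcap_i Y sg i @^-1` B i) = \prod_i P (Y sg i @^-1` B i))%E.
  move=> oB; pose h x := sg * (dot x u * dot x v - dot u v).
  have ch : continuous h by exact: continuous_dot_dot.
  have := ind [set: 'I_m]%SET (fun i => h @^-1` B i).
  rewrite (_ : [set` [set: 'I_m]%SET] = setT); last first.
    by apply/seteqP; split => // i _; rewrite /= inE.
  rewrite (eq_bigl xpredT) => [|i]; last by rewrite finset.in_setT.
  apply => i _; apply: sub_sigma_algebra.
  by move/continuousP : ch; apply; exact: oB.
have T sg : `|sg| = 1 -> (P [set w | (s * r < \sum_i Y sg i w)%R]
    <= (C * expR (- (c * (s `^ alpha / L ^+ 4))))%:E)%E.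
  move=> sg1; apply: (H _ _ P m L s r (Y sg) U) => //; last exact: iY.
  by move=> i w; exact: YU.
have sumY tau w : \sum_i Y tau i w = tau * (dot (A w *m u) (A w *m v) - m%:R * dot u v).
  rewrite -mulr_sumr sumrB; congr (_ * (_ - _)).
    by apply: eq_bigr => i _; rewrite !mulmx_dot_row.
  by rewrite sumr_const card_ord mulr_natl.
rewrite mulrDl; apply: (@prob_le_add _ _ _ _ [set w | s * r < \sum_i Y 1 i w]
  [set w | s * r < \sum_i Y (-1) i w]).
- by apply: measurable_gt; exact: measurable_sum.
- by apply: measurable_gt; exact: measurable_sum.
- apply: measurable_gt; apply: measurableT_comp => //; apply: measurable_funB => //.
  apply: measurable_sum => i.
  by apply: measurable_funM => //; under eq_fun do rewrite mulmx_dot_row; exact: mX.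
- move=> w /=; rewrite !sumY mul1r mulN1r; case: (ler0P (_ - _)) => _ ->.
    by right.
  by left.
- by apply: T; rewrite normr1.
- by apply: T; rewrite normrN1.
Qed.


Lemma dev_increment_tail : exists c C : R, [/\ 0 < c, 0 < C &
  forall d (Om : measurableType d) (P : probability Om R) m n (A : Om -> 'M[R]_(m, n))
    (L s : R) (x y : 'cV[R]_n),
  random_matrix A -> independent_vectors P (matrix_row A) ->
  (forall i, isotropic P (matrix_row A i)) -> 1 <= L ->
  (forall i x, norm2 x = 1 ->
    (\int[P]_w (expR ((`|dot (matrix_row A i w) x| / L) `^ alpha))%:E <= 2%:E)%E) ->
  0 <= s ->
  (P [set w | (s * norm2 (x - y) < `|dev (A w) x - dev (A w) y|)%R]
    <= (C * expR (- (c * (s `^ alpha / L ^+ 4))))%:E)%E].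
Proof.
have a0 := alpha_gt0; have a2 := alpha_le2.
have [c [C [c0 C0 H]]] := quadratic_form_tail.
(* General vectors reduce to unit ones at level [s / 4], and a pair of these to single forms at
   [s / 4 / 4]; [alpha <= 2] gives [16^-alpha >= 16^-2]. The pair contributes two events, the lone
   unit vector a third. *)
exists (c / (16 * 16)), (C + C + C); split; [by rewrite divr_gt0 ?mulr_gt0|by rewrite !addr_gt0|].
move=> d Om P m n A L s x y mA ind iso L1 psi s0.
have L0 : 0 < L by rewrite (lt_le_trans _ L1).
have [q qE] : exists q : R -> R, forall t, q t = C * expR (- (c * (t `^ alpha / L ^+ 4))).
  by eexists.
have q0 t : 0 <= q t by rewrite qE mulr_ge0 ?expR_ge0// ltW.
have qle (t t' : R) : 0 <= t -> t <= t' -> q t' <= q t.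
  move=> t0 tt'; rewrite !qE ler_pM2l// ler_expR lerN2 ler_pM2l//.
  rewrite ler_wpM2r ?invr_ge0 ?exprn_ge0 ?(ltW L0)//.
  by rewrite ge0_ler_powR ?(ltW a0)// nnegrE (le_trans t0).
have mdev z : measurable_fun setT (fun w => dev (A w) z) by exact: measurable_dev.
have mdevn z (t : R) : measurable [set w | t < `|dev (A w) z|].
  by apply: measurable_gt; exact: measurableT_comp.
have mnorm z z' (t : R) : measurable [set w | t < `|norm2 (A w *m z) - norm2 (A w *m z')|].
  apply: measurable_gt; apply: measurableT_comp => //.
  by apply: measurable_funB; exact: measurable_norm2_mulmx.
have mdot z z' (t : R) : measurable [set w | t < `|dot (A w *m z) (A w *m z') - m%:R * dot z z'|].
  apply: measurable_gt; apply: measurableT_comp => //.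
  by apply: measurable_funB => //; exact: measurable_dot_mulmx.
have unit u (t : R) : norm2 u = 1 -> 0 <= t -> (P [set w | (t < `|dev (A w) u|)%R] <= (q t)%:E)%E.
  move=> u1 t0; pose r := Num.max (Num.sqrt m%:R) t.
  rewrite qE; apply: le_trans (H _ _ P _ _ A L t r u u mA ind iso L1 psi t0 _ _ u1 u1).
  - apply: le_measure; rewrite ?inE//.
    by move=> w /= h; exact: dev_unit_sub.
  - by rewrite /r le_max lexx orbT.
  - rewrite -[leLHS](@sqr_sqrtr R) ?ler0n// lerXn2r ?nnegrE ?sqrtr_ge0//.
      by rewrite /r le_max sqrtr_ge0.
    by rewrite /r le_max lexx.
have unit2 u v (t : R) : norm2 u = 1 -> norm2 v = 1 -> 0 <= t ->
    (P [set w | (t * norm2 (u - v) < `|norm2 (A w *m u) - norm2 (A w *m v)|)%R]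
      <= (q (t / 4) + q (t / 4))%:E)%E.
  move=> u1 v1 t0; have t40 : 0 <= t / 4 by rewrite divr_ge0.
  have [<-|uv] := eqVneq u v.
    rewrite (_ : [set w | _] = set0) ?measure0 ?lee_fin ?addr_ge0//.
    by apply/seteqP; split=> w //=; rewrite !subrr norm2_0 mulr0 normr0 ltxx.
  have hD := norm2_normalize (_ : u - v != 0); rewrite subr_eq0 in hD; have {}hD := hD uv.
  have sub w := @norm2_unit_sub R m n (A w) u v t u1 v1 uv t0.
  have [gs|gs] := leP (2 * Num.sqrt m%:R) t.
    apply: (@le_trans _ _ (q (t / 4))%:E); last by rewrite lee_fin lerDl.
    apply: le_trans (unit _ _ hD t40).
    apply: le_measure; rewrite ?inE//.
    by move=> w /= /sub; rewrite gs.
  have [e|uv'] := eqVneq (u + v) 0.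
    rewrite (_ : [set w | _] = set0) ?measure0 ?lee_fin ?addr_ge0//.
    apply/seteqP; split=> w //= /sub; rewrite leNgt gs/= => -[].
    by rewrite e eqxx.
  rewrite {2}qE; apply: (prob_le_add _ _ _ _ (unit _ _ u1 t40)
    (H _ _ P _ _ A L (t / 4) (Num.sqrt m%:R) _ _ mA ind iso L1 psi t40 _ _ hD
      (norm2_normalize uv'))) => //.
  - by move=> w /= /sub; rewrite leNgt gs/= => -[_ []]; [left|right].
  - lra.
  - by rewrite sqr_sqrtr.
have fin : q (s / 4 / 4) + q (s / 4 / 4) + q (s / 4) <=
    (C + C + C) * expR (- (c / (16 * 16) * (s `^ alpha / L ^+ 4))).
  have s16 : 0 <= s / 4 / 4 by rewrite !divr_ge0.
  apply: (@le_trans _ _ (3 * q (s / 4 / 4))).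
    have : q (s / 4) <= q (s / 4 / 4) by apply: qle => //; lra.
    lra.
  rewrite qE (_ : C + C + C = 3 * C); last by ring.
  rewrite mulrA ler_pM2l ?mulr_gt0// ler_expR lerN2.
  rewrite (_ : s / 4 / 4 = 16^-1 * s); last by field.
  rewrite powRM ?invr_ge0// -[leLHS]mulrA ler_pM2l// mulrA.
  rewrite ler_wpM2r ?invr_ge0 ?exprn_ge0 ?(ltW L0)// ler_wpM2r ?powR_ge0//.
  rewrite (_ : (16 * 16)^-1 = 16^-1 `^ 2%:R); last by rewrite powR_mulrn// exprVn expr2.
  by rewrite ger_powR//; apply/andP; split; lra.
have gen z z' : norm2 z <= norm2 z' ->
    (P [set w | (s * norm2 (z - z') < `|dev (A w) z - dev (A w) z'|)%R]
      <= ((C + C + C) * expR (- (c / (16 * 16) * (s `^ alpha / L ^+ 4))))%:E)%E.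
  move=> zz'; have s40 : 0 <= s / 4 by rewrite divr_ge0.
  have mZ : measurable [set w | s * norm2 (z - z') < `|dev (A w) z - dev (A w) z'|].
    by apply: measurable_gt; apply: measurableT_comp => //; exact: measurable_funB.
  apply: le_trans (_ : (q (s / 4 / 4) + q (s / 4 / 4) + q (s / 4))%:E <= _)%E; last first.
    by rewrite lee_fin.
  have [z0|z0] := eqVneq z 0.
    rewrite z0; have [->|z'0] := eqVneq z' 0.
      rewrite (_ : [set w | _] = set0) ?measure0 ?lee_fin ?addr_ge0//.
      by apply/seteqP; split=> w //=; rewrite !subrr norm2_0 mulr0 normr0 ltxx.
    have z'1 := norm2_normalize z'0.
    apply: (@le_trans _ _ (q (s / 4))%:E); last by rewrite lee_fin lerDr addr_ge0.
    apply: le_trans (unit _ _ z'1 s40).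
    apply: le_measure; rewrite ?inE//; first by rewrite -z0.
    have n0 : 0 < norm2 z' by rewrite lt_def norm2_eq0 z'0 norm2_ge0.
    move=> w /=; rewrite dev0 !sub0r norm2N normrN devZ normrM normr_id => h.
    rewrite (gtr0_norm (_ : 0 < (norm2 z')^-1)) ?invr_gt0//.
    rewrite [ltRHS]mulrC ltr_pdivlMr// (le_lt_trans _ h)// ler_wpM2r ?norm2_ge0//; lra.
  have z'0 : z' != 0.
    rewrite -norm2_eq0 gt_eqF// (lt_le_trans _ zz')// lt_def norm2_eq0 z0.
    exact: norm2_ge0.
  have z1 := norm2_normalize z0; have z'1 := norm2_normalize z'0.
  apply: (prob_le_add _ _ _ _ (unit2 _ _ _ z1 z'1 s40) (unit _ _ z'1 s40)) => //.
  by move=> w /= h; exact: dev_sub.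
have [|/ltW yx] := leP (norm2 x) (norm2 y); first exact: gen.
rewrite norm2B (_ : [set w | _] =
  [set w | s * norm2 (y - x) < `|dev (A w) y - dev (A w) x|]); first exact: gen.
by apply/funext => w /=; rewrite distrC.
Qed.

End Increments.

(** * The psi-norm hypothesis *)

Section PsiNorm.
Context (R : realType) (alpha : R).
Hypotheses (alpha_gt0 : 0 < alpha) (alpha_le2 : alpha <= 2).

(** The strict inequality [K < L] yields an admissible scale [t < L] whether or not the infimum is
    attained, and the moment decreases in the scale. *)
Lemma psi_norm_exp_moment d (Om : measurableType d) (P : probability Om R)
    (f : Om -> R) (K L : R) : measurable_fun setT f ->
  (psi_norm P alpha f <= K%:E)%E -> K < L ->
  (\int[P]_w (expR ((`|f w| / L) `^ alpha))%:E <= 2%:E)%E.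
Proof.
move=> mf fK KL.
have : (psi_norm P alpha f < L%:E)%E by rewrite (le_lt_trans fK)// lte_fin.
move=> /ereal_inf_lt[_ [t [t0 Et] <-]]; rewrite lte_fin => tL.
apply: le_trans Et; rewrite unlock.
have E w : `|f w / t| = `|f w| / t by rewrite normrM normfV (gtr0_norm t0).
apply: ge0_le_integral => //.
- by apply/measurable_EFinP; apply: measurable_expR_powR; exact: measurableT_comp.
- apply/measurable_EFinP; under eq_fun do rewrite E.
  by apply: measurable_expR_powR; exact: measurableT_comp.
- move=> w _; rewrite lee_fin ler_expR E ge0_ler_powR ?(ltW alpha_gt0)//.
  + by rewrite nnegrE divr_ge0// (le_trans (ltW t0))// ltW.
  + by rewrite nnegrE divr_ge0// ltW.
  + rewrite ler_wpM2l// lef_pV2 ?posrE// ?(ltW tL)//; exact: lt_trans tL.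
Qed.

(* With isotropy this bounds [K] from below, so that additive constants can be
   absorbed into powers of [K]. *)
Lemma second_moment_le : exists2 kappa : R, 0 < kappa <= 1 &
  forall d (Om : measurableType d) (P : probability Om R) (f : Om -> R) (L : R),
  measurable_fun setT f -> 0 < L ->
  (\int[P]_w (f w * f w)%:E = 1)%E ->
  (\int[P]_w (expR ((`|f w| / L) `^ alpha))%:E <= 2%:E)%E -> kappa < L.
Proof.
have a0 := alpha_gt0.
have [C C0 HC] := @powR_le_expR R (2 / alpha) (divr_gt0 (ltr0n _ 2) a0).
(* For [L] at most this value the second moment would be at most [2 * C * L ^+ 2 <= 2 * C / (2 * C +
   1) < 1]. *)
exists (2 * C + 1)^-1.
  rewrite invr_gt0 invf_le1 ?addr_gt0 ?mulr_gt0//= lerDr mulr_ge0// ltW//.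
move=> d Om P f L mf L0 E1 E2; rewrite ltNge; apply/negP => Lk.
have h w : f w * f w <= L ^+ 2 * C * expR ((`|f w| / L) `^ alpha).
  have x0 : 0 <= `|f w| / L by rewrite divr_ge0// ltW.
  have := HC _ (powR_ge0 (`|f w| / L) alpha).
  rewrite -powRrM (_ : alpha * (2 / alpha) = 2%:R); last by field; rewrite gt_eqF.
  rewrite powR_mulrn// expr_div_n ler_pdivrMr ?exprn_gt0// => h.
  rewrite -expr2 -real_normK ?num_real// (le_trans h)//.
  by rewrite mulrC mulrA.
have : (1 <= (L ^+ 2 * C)%:E * 2%:E)%E.
  have LC : 0 <= L ^+ 2 * C by rewrite mulr_ge0 ?sqr_ge0// ltW.
  have mE : measurable_fun setT (fun w => expR ((`|f w| / L) `^ alpha)).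
    by apply: measurable_expR_powR; exact: measurableT_comp.
  rewrite -E1 (le_trans _ (lee_wpmul2l _ E2)) ?lee_fin//.
  rewrite -ge0_integralZl_EFin//; last exact/measurable_EFinP.
  apply: ge0_le_integral => //.
  - by move=> w _; rewrite lee_fin -expr2 sqr_ge0.
  - by apply/measurable_EFinP; exact: measurable_funM.
  - by apply: measurable_funeM; exact/measurable_EFinP.
  - by move=> w _; rewrite -EFinM lee_fin.
rewrite -EFinM lee_fin leNgt => /negP; apply.
have C1 : 0 < 2 * C + 1 by lra.
have L1 : L <= 1 by rewrite (le_trans Lk)// invf_le1//; lra.
have L2 : L ^+ 2 <= (2 * C + 1)^-1 by rewrite (le_trans _ Lk)// expr2 ler_piMl// ltW.
apply: (@le_lt_trans _ _ ((2 * C + 1)^-1 * (2 * C))).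
  by rewrite -mulrA (mulrC C) ler_wpM2r// mulr_ge0// ltW.
by rewrite mulrC ltr_pdivrMr// mul1r ltrDl.
Qed.

(** Brings the increment tail to the normalized form that chaining uses. The alternative in the
    first conjunct covers matrices without rows or columns, for which [K] may be 0. *)
Lemma dev_subgaussian : exists2 B0 : R, 0 < B0 &
  forall d (Om : measurableType d) (P : probability Om R) m n (A : Om -> 'M[R]_(m, n)) (K : R),
  random_matrix A -> independent_vectors P (matrix_row A) ->
  (forall i, isotropic P (matrix_row A i)) ->
  (forall i, (psi_norm_vec P alpha (matrix_row A i) <= K%:E)%E) ->
  (0 < K `^ (4 / alpha) \/ forall w x, dev (A w) x = 0) /\
  forall (x y : 'cV[R]_n) (s : R), 0 <= s ->
  (P [set w | (s * (B0 * K `^ (4 / alpha)) * norm2 (x - y) < `|dev (A w) x - dev (A w) y|)%R]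
    <= (2 * expR (- (s `^ alpha)))%:E)%E.
Proof.
have a0 := alpha_gt0.
have [c [C [c0 C0 H]]] := dev_increment_tail alpha_gt0 alpha_le2.
have [kap /andP[kap0 kap1] Hkap] := second_moment_le.
have l20 : 0 < ln 2 :> R by rewrite ln_gt0// ltr1n.
(* The factor [q] turns the prefactor into 2: if [s^alpha <= ln 2] the target is at least 1, and
   otherwise [C / ln 2 * s^alpha >= C], whose exponential exceeds [C]. *)
have [q [q0 q1]] : exists q : R, 0 < q /\ q = 1 + C / ln 2.
  by eexists; split; [|reflexivity]; rewrite addr_gt0// divr_gt0.
have b0 : 0 < q * (2 / kap) ^+ 4 / c.
  by apply: divr_gt0 => //; apply: mulr_gt0 => //; apply: exprn_gt0; exact: divr_gt0.
(* With this constant and [L = 2 / kap * K], the exponent at level [s * (B0 * K^(4 / alpha))] is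
   exactly [q * s^alpha]. The factor [2 / kap] ensures [L >= 1] and [L > K]. *)
exists ((q * (2 / kap) ^+ 4 / c) `^ alpha^-1); first exact: powR_gt0.
move=> d Om P m n A K mA ind iso psi.
have [mn0|] := boolP ((m == 0)%N || (n == 0)%N).
  have D0 w x : dev (A w) x = 0 by exact: dev_trivial.
  split; first by right.
  move=> x y s s0; rewrite (_ : [set w | _] = set0) ?measure0 ?lee_fin ?mulr_ge0 ?expR_ge0//.
  apply/seteqP; split=> w //=; rewrite !D0 subrr normr0 ltNge !mulr_ge0 ?powR_ge0//.
  exact: norm2_ge0.
rewrite negb_or -!lt0n => /andP[m0 n0].
have e1 : norm2 (delta_mx (Ordinal n0) 0 : 'cV[R]_n) = 1.
  rewrite norm2_sqrt_dot /dot (bigD1 (Ordinal n0))//= big1 ?addr0 => [|i ni].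
    by rewrite mxE !eqxx mulr1 sqrtr1.
  by rewrite mxE (negbTE ni) mul0r.
have mom L i x : norm2 x = 1 -> K < L ->
    (\int[P]_w (expR ((`|dot (matrix_row A i w) x| / L) `^ alpha))%:E <= 2%:E)%E.
  move=> x1 KL; apply: (psi_norm_exp_moment (measurable_dot_row mA i x) _ KL).
  by apply: le_trans (psi i); apply: ereal_sup_ubound; exists x.
(* A coordinate of a row has second moment 1 by isotropy; if [K < kap], its exponential moment at
   scale [kap] would be at most 2, against [Hkap]. *)
have kK : kap <= K.
  rewrite leNgt; apply/negP => Kk.
  have [iX EX] := expectation_dot_row mA (delta_mx (Ordinal n0) 0)
    (delta_mx (Ordinal n0) 0) (iso (Ordinal m0)).
  rewrite -norm2_sqr e1 expr1n in EX.
  have := Hkap _ _ P _ kap (measurable_dot_row mA _ _) kap0 EX (mom _ _ _ e1 Kk).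
  by rewrite ltxx.
have K0 : 0 < K by exact: lt_le_trans kK.
have K40 : 0 < K `^ (4 / alpha) by exact: powR_gt0.
split; first by left.
have [L [L1 LK LE]] : exists L : R, [/\ 1 <= L, K < L & L = 2 / kap * K].
  exists (2 / kap * K); split => //.
    rewrite mulrAC ler_pdivlMr// mul1r; lra.
  rewrite mulrAC ltr_pdivlMr//; nra.
move=> x y s s0.
have ex : c * ((s * ((q * (2 / kap) ^+ 4 / c) `^ alpha^-1 * K `^ (4 / alpha))) `^ alpha / L ^+ 4)
    = q * s `^ alpha.
  rewrite powRM ?mulr_ge0 ?powR_ge0// powRM ?powR_ge0// -!powRrM.
  rewrite (_ : alpha^-1 * alpha = 1) ?mulVf ?gt_eqF// powRr1 ?(ltW b0)//.
  rewrite (_ : 4 / alpha * alpha = 4%:R) ?divfK ?gt_eqF// powR_mulrn ?(ltW K0)//.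
  by rewrite LE exprMn; field; rewrite !gt_eqF.
have := H _ _ P _ _ A L
  (s * ((q * (2 / kap) ^+ 4 / c) `^ alpha^-1 * K `^ (4 / alpha))) x y mA ind iso L1
  (fun i x x1 => mom L i x x1 LK) (mulr_ge0 s0 (mulr_ge0 (powR_ge0 _ _) (powR_ge0 _ _))).
rewrite ex => HP.
have [sl|sl] := leP (s `^ alpha) (ln 2).
  rewrite (le_trans (probability_le1 _ _))//.
    apply: measurable_gt; apply: measurableT_comp => //.
    by apply: measurable_funB; exact: measurable_dev.
  rewrite lee_fin -[in leRHS](@lnK R 2) ?posrE// -expRD -[leLHS]expR0 ler_expR; lra.
apply: (le_trans HP); rewrite lee_fin.
have -> : - (q * s `^ alpha) = - (s `^ alpha) + - (C / ln 2 * s `^ alpha) by rewrite q1; ring.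
rewrite expRD mulrCA mulrC ler_wpM2r ?expR_ge0//.
have h : C <= C / ln 2 * s `^ alpha.
  by rewrite mulrAC ler_pdivlMr// ler_wpM2l// ltW.
have h1 : 1 + C <= expR (C / ln 2 * s `^ alpha).
  by rewrite (le_trans (expR_ge1Dx _))// ler_expR.
by rewrite expRN ler_pdivrMr ?expR_gt0//; lra.
Qed.

End PsiNorm.

(** * Partitions and chains *)

Section Partitions.
Context {X : choiceType}.
Implicit Types (F : set (set X)) (T S : set X).

Lemma pblockP F T x : partition F id T -> T x ->
  F (pblock F id x) /\ pblock F id x x.
Proof.
move=> [<- _ _] [S FS Sx].
by apply: (@getPex _ (fun S => F S /\ S x)); exists S.
Qed.

Lemma pblock_eq F T S x : partition F id T -> F S -> S x -> pblock F id x = S.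
Proof.
move=> pF FS Sx; have [cF tF _] := pF.
have [FB Bx] : F (pblock F id x) /\ pblock F id x x.
  by apply: (pblockP pF); rewrite -cF; exists S.
by apply: tF => //; exists x.
Qed.

Lemma partition_sub F T S : partition F id T -> F S -> S `<=` T.
Proof. by move=> [<- _ _] FS x Sx; exists S. Qed.

End Partitions.

Section Chain.
Context {R : realType} {n : nat}.
Implicit Types (T S : set 'cV[R]_n) (t : 'cV[R]_n).

Lemma diam_ge S s t : S s -> S t -> ((norm2 (s - t))%:E <= diam S)%E.
Proof. by move=> Ss St; apply: ereal_sup_ubound; exists s => //; exists t. Qed.

Lemma diam_ge0 S s : S s -> (0 <= diam S)%E.
Proof. by move=> Ss; have := diam_ge Ss Ss; rewrite subrr norm2_0. Qed.

(* [p k i] is a chosen point of the [i]-th block of level [k], and [par k j] is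
   the index of the block of level [k] containing the [j]-th block of level
   [k.+1]. *)
Lemma chain_of_admissible (alpha : R) T F (G : R) : T !=set0 -> admissible T F ->
  (forall t, T t -> (\sum_(0 <= k <oo)
     (2 `^ (k%:R / alpha))%:E * diam (pblock (F k) id t) <= G%:E)%E) ->
  exists (p : nat -> nat -> 'cV[R]_n) (par : nat -> nat -> nat),
    (forall k i, T (p k i)) /\
    forall t, T t -> exists i : nat -> nat,
      [/\ forall k, (i k < 2 ^ (2 ^ k))%N,
          forall k, par k (i k.+1) = i k,
          forall N, \sum_(k < N) 2 `^ (k%:R / alpha) *
            norm2 (p k.+1 (i k.+1) - p k (i k)) <= G &
          forall k, 2 `^ (k%:R / alpha) * norm2 (t - p k (i k)) <= G].
Proof.
move=> T0 [pF rF F0 FN] HG.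
have cF k : F k #<= `I_(2 ^ (2 ^ k)).
  case: k => [|k]; last exact: FN.
  have [F01 _] := (card_eqPle _ _).1 F0.
  by apply: card_le_trans F01 _; rewrite card_le_II.
(* Coding the blocks by integers lets the union bounds of the chaining range over ordinals. *)
have [code codeP] : exists code : nat -> set 'cV[R]_n -> nat, forall k,
    (forall S, F k S -> (code k S < 2 ^ (2 ^ k))%N) /\ {in F k &, injective (code k)}.
  suff /choice[code Hc] : forall k, exists c : set 'cV[R]_n -> nat,
      (forall S, F k S -> (c S < 2 ^ (2 ^ k))%N) /\ {in F k &, injective c}.
    by exists code.
  move=> k.
  have /pcard_leP[f] := cF k; exists f; split; last exact: 'inj_f.
  by move=> S FS; exact: 'funS_f.
have Bt k t : T t -> F k (pblock (F k) id t) /\ pblock (F k) id t t.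
  by move=> Tt; exact: (pblockP (pF k)).
(* A code that no block carries is decoded to an arbitrary block, so every [p k i] lies in [T]. *)
have [dec decP] : exists dec : nat -> nat -> set 'cV[R]_n, forall k i,
    F k (dec k i) /\ forall S, F k S -> code k S = i -> dec k i = S.
  have /choice[dec Hdec] : forall ki : nat * nat, exists S, F ki.1 S /\
      forall S', F ki.1 S' -> code ki.1 S' = ki.2 -> S = S'.
    move=> [k i]/=; have [t Tt] := T0.
    have [[S [FS <-]]|nS] := pselect (exists S, F k S /\ code k S = i).
      exists S; split=> // S' FS' e; have [_ ci] := codeP k.
      by apply: ci; rewrite ?inE.
    exists (pblock (F k) id t); split; first exact: (Bt k t Tt).1.
    by move=> S FS e; exfalso; apply: nS; exists S.
  by exists (fun k i => dec (k, i)) => k i; exact: (Hdec (k, i)).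
have [p pP] : exists p : nat -> nat -> 'cV[R]_n, forall k i, dec k i (p k i).
  have /choice[p Hp] : forall ki : nat * nat, exists x, dec ki.1 ki.2 x.
    move=> [k i]/=; have [_ _ ne] := pF k; exact: ne (decP k i).1.
  by exists (fun k i => p (k, i)) => k i; exact: (Hp (k, i)).
have pT k i : T (p k i) by apply: (partition_sub (pF k) (decP k i).1).
exists p, (fun k j => code k (pblock (F k) id (p k.+1 j))); split=> // t Tt.
pose B k := pblock (F k) id t.
have BF k : F k (B k) by exact: (Bt k t Tt).1.
have Btt k : B k t by exact: (Bt k t Tt).2.
have decB k : dec k (code k (B k)) = B k by apply: (decP k _).2.
have Bsub k : B k.+1 `<=` B k.
  have [S FS SB] := rF k _ (BF k.+1).
  by rewrite {2}/B (pblock_eq (pF k) FS (SB _ (Btt k.+1))).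
have pB k : B k (p k (code k (B k))) by have := pP k (code k (B k)); rewrite decB.
have tm0 k : (0 <= (2 `^ (k%:R / alpha))%:E * diam (B k))%E.
  by rewrite mule_ge0 ?lee_fin ?powR_ge0//; exact: diam_ge0 (Btt k).
have part N : (\sum_(0 <= k < N) (2 `^ (k%:R / alpha))%:E * diam (B k) <= G%:E)%E.
  by apply: le_trans (HG t Tt); apply: nneseries_lim_ge => k _ _.
exists (fun k => code k (B k)); split.
- by move=> k; have [+ _] := codeP k; apply.
- by move=> k; congr code; apply: (pblock_eq (pF k) (BF k)); exact: Bsub.
(* Refinement puts both endpoints of the [k]-th link in the block of [t] at level [k], so the
   coarser diameter pays for it. *)
- move=> N; rewrite -lee_fin -sumEFin; apply: le_trans (part N).
  rewrite big_mkord; apply: lee_sum => k _; rewrite EFinM.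
  by rewrite lee_wpmul2l ?lee_fin ?powR_ge0//; apply: diam_ge => //; exact: Bsub.
- move=> k; rewrite -lee_fin; apply: le_trans (part k.+1).
  rewrite big_nat_recr//= EFinM.
  apply: (@le_trans _ _ ((2 `^ (k%:R / alpha))%:E * diam (B k))%E).
    by rewrite lee_wpmul2l ?lee_fin ?powR_ge0//; exact: diam_ge.
  by rewrite leeDr// sume_ge0.
Qed.

End Chain.

(** * Generic chaining *)

Lemma dyadic_level (R : realType) (y : R) : 1 <= y ->
  exists l : nat, 2 ^+ l <= y < 2 ^+ l.+1.
Proof.
move=> y1.
have ex : exists n, y < 2 ^+ n.
  exists (Num.bound y); have y0 : 0 <= y by rewrite (le_trans _ y1).
  rewrite (lt_trans (archi_boundP y0))// -natrX ltr_nat.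
  exact: ltn_expl.
case: (ex_minnP ex) => -[|l] yl lmin; first by move: yl; rewrite expr0 ltNge y1.
exists l; rewrite yl andbT leNgt; apply/negP => /lmin.
by rewrite ltnn.
Qed.

Section Chaining.
Context (R : realType) (alpha : R).
Hypotheses (alpha_gt0 : 0 < alpha) (alpha_le2 : alpha <= 2).
Context d (Om : measurableType d) (P : probability Om R) (n : nat).
Context (Z : 'cV[R]_n -> Om -> R) (T : set 'cV[R]_n) (G : R).
Context (p : nat -> nat -> 'cV[R]_n) (par : nat -> nat -> nat).
Hypothesis lipZ : forall w, exists2 l : R, 0 <= l &
  forall x y, `|Z x w - Z y w| <= l * norm2 (x - y).
Hypothesis chainT : forall t, T t -> exists i : nat -> nat,
  [/\ forall k, (i k < 2 ^ (2 ^ k))%N,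
      forall k, par k (i k.+1) = i k,
      forall N, \sum_(k < N) 2 `^ (k%:R / alpha) *
        norm2 (p k.+1 (i k.+1) - p k (i k)) <= G &
      forall k, 2 `^ (k%:R / alpha) * norm2 (t - p k (i k)) <= G].

(** For fixed [w] the process is Lipschitz and [p k (i k)] approaches [t] like [2^(-k / alpha)]. The
    bound [l <= k] keeps the level beyond the start of the chain. *)
Lemma chain_cvg t w (eps : R) (l : nat) (i : nat -> nat) : 0 < eps ->
  (forall k, 2 `^ (k%:R / alpha) * norm2 (t - p k (i k)) <= G) ->
  exists2 k, (l <= k)%N & `|Z t w - Z (p k (i k)) w| <= eps.
Proof.
have a0 := alpha_gt0; have a2 := alpha_le2.
move=> e0 iG; have [lip lip0 Hlip] := lipZ w.
have G0 : 0 <= G by apply: le_trans (iG 0%N); rewrite mulr_ge0 ?powR_ge0 ?norm2_ge0.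
have lG0 : 0 <= lip * G / eps by rewrite divr_ge0 ?mulr_ge0// ltW.
pose j := (Num.bound (lip * G / eps) + l)%N.
(* Doubling the level gives [2^(2 * j / alpha) >= 2 ^+ j], because [alpha <= 2]. *)
exists (2 * j)%N; first by rewrite /j; lia.
rewrite (le_trans (Hlip _ _))//.
have h1 : lip * G / eps <= 2 `^ ((2 * j)%:R / alpha).
  apply: (@le_trans _ _ (2 ^+ j)).
    rewrite (le_trans (ltW (archi_boundP lG0)))// -natrX ler_nat.
    by rewrite (leq_trans (leq_addr l _))// ltnW// ltn_expl.
  rewrite -powR_mulrn// ler_powR ?ler1n// natrM mulrAC ler_peMl//.
  by rewrite ler_pdivlMr// mul1r.
have q0 : 0 < 2 `^ ((2 * j)%:R / alpha) :> R by exact: powR_gt0.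
rewrite -(ler_pM2l q0) mulrCA.
apply: (@le_trans _ _ (lip * G)); first by rewrite ler_wpM2l.
by rewrite -ler_pdivrMr.
Qed.

(** Reduces a supremum over an arbitrary [T] to countably many points, which makes the deviation
    events measurable. *)
Lemma chain_dense c w :
  (forall k i, `|Z (p k i) w| <= c) -> forall t, T t -> `|Z t w| <= c.
Proof.
move=> H t Tt; apply/ler_addgt0Pr => e e0.
have [i [_ _ _ iG]] := chainT Tt.
have [k _ he] := chain_cvg w 0 e0 iG.
have -> : Z t w = Z (p k (i k)) w + (Z t w - Z (p k (i k)) w) by rewrite addrC subrK.
by rewrite (le_trans (ler_normD _ _))// lerD.
Qed.

Context (B : R).
Hypothesis mZ : forall x, measurable_fun setT (Z x).
Hypothesis Z0 : forall w, Z 0 w = 0.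
Hypothesis B0 : 0 <= B.
Hypothesis tailZ : forall (x y : 'cV[R]_n) (s : R), 0 <= s ->
  (P [set w | (s * B * norm2 (x - y) < `|Z x w - Z y w|)%R]
    <= (2 * expR (- (s `^ alpha)))%:E)%E.
Hypothesis pT : forall k i, T (p k i).

(* The chain starts at the level [l] with [2^l <= u^alpha < 2^(l+1)]: there are
   few enough points at that level for [u] to multiply the radius only, and all
   later links have probabilities summing to a multiple of [exp(-u^alpha)]. *)
Lemma chaining_tail (u rT : R) : 1 <= u -> (forall t, T t -> norm2 t <= rT) ->
  exists2 bad : set Om, measurable bad /\ (P bad <= (4 * expR (- (u `^ alpha)))%:E)%E &
  forall w, ~ bad w -> forall t, T t ->
    `|Z t w| <= B * (6 `^ alpha^-1 * G + 2 `^ alpha^-1 * u * rT).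
Proof.
have a0 := alpha_gt0; have a2 := alpha_le2.
move=> u1 Tr; have u0 : 0 < u by rewrite (lt_le_trans _ u1).
have y1 : 1 <= u `^ alpha by rewrite -(powRr0 u) ler_powR// ltW.
set y := u `^ alpha in y1 *.
have y0 : 0 < y by rewrite (lt_le_trans _ y1).
have [l /andP[ly yl]] := dyadic_level y1.
pose E (x z : 'cV[R]_n) (s : R) := [set w | s * B * norm2 (x - z) < `|Z x w - Z z w|].
have mE x z s : measurable (E x z s).
  by apply: measurable_gt; apply: measurableT_comp => //; exact: measurable_funB.
have ai0 : 0 < alpha^-1 by rewrite invr_gt0.
have PE (x z : 'cV[R]_n) (v : R) : 0 <= v -> (P (E x z (v `^ alpha^-1)%R) <= (2 * expR (- v))%:E)%E.
  move=> v0; have := tailZ x z (powR_ge0 v alpha^-1).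
  by rewrite -powRrM mulVf ?gt_eqF// powRr1.
pose Nk k := (2 ^ (2 ^ k))%N.
have NkE k : (Nk k)%:R <= expR (2 ^+ k) :> R.
  rewrite /Nk natrX -[X in X ^+ _]/(1 + 1) (@le_trans _ _ (expR 1 ^+ (2 ^ k)))//.
    by rewrite lerXn2r ?nnegrE ?expR_ge0// expR_ge1Dx.
  by rewrite -expRM_natl mulr1 natrX.
(* Of the exponent [2 * y], one [y] pays for the at most [expR y] starting points. Of
   [3 * 2 ^+ k.+1], one third pays for the number of links, one is at least [y] because [l <= k],
   and the last makes the sum over [k] converge. *)
pose s0 := (2 * y) `^ alpha^-1.
pose sk k := (3 * 2 ^+ k.+1) `^ alpha^-1 : R.
pose bad0 := \big[setU/set0]_(i < Nk l) E (p l i) 0 s0.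
(* Through [par] a link is determined by its finer endpoint, so there are only [Nk k.+1] of them. *)
pose bad1 k := if (l <= k)%N then
  \big[setU/set0]_(j < Nk k.+1) E (p k.+1 j) (p k (par k j)) (sk k) else set0.
have mbad0 : measurable bad0 by exact: bigsetU_measurable.
have mbad1 k : measurable (bad1 k).
  by rewrite /bad1; case: ifP => // _; exact: bigsetU_measurable.
have Pbad0 : (P bad0 <= (2 * expR (- y))%:E)%E.
  apply: (@le_trans _ _ ((Nk l)%:R * (2 * expR (- (2 * y))))%:E).
    by apply: prob_bigU_le => // i; apply: PE; rewrite mulr_ge0// ltW.
  rewrite lee_fin mulrCA ler_pM2l//.
  apply: (@le_trans _ _ (expR y * expR (- (2 * y)))).
    by rewrite ler_wpM2r ?expR_ge0// (le_trans (NkE l))// ler_expR.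
  by rewrite -expRD ler_expR; lra.
have Pbad1 k : (P (bad1 k) <= (2 * expR (- y) / (2 ^ k.+1)%:R)%:E)%E.
  have pos : 0 <= 2 * expR (- y) / (2 ^ k.+1)%:R by rewrite divr_ge0 ?mulr_ge0 ?expR_ge0.
  rewrite /bad1; case: ifP => [lk|_]; last by rewrite measure0 lee_fin.
  set x : R := 2 ^+ k.+1.
  have x0 : 0 < x by rewrite exprn_gt0.
  have yx : y <= x by rewrite (le_trans (ltW yl))// ler_weXn2l// ler1n.
  apply: (@le_trans _ _ ((Nk k.+1)%:R * (2 * expR (- (3 * x))))%:E).
    by apply: prob_bigU_le => // i; apply: PE; rewrite mulr_ge0// ltW.
  rewrite lee_fin mulrCA -mulrA ler_pM2l//.
  apply: (@le_trans _ _ (expR x * expR (- (3 * x)))).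
    by rewrite ler_wpM2r ?expR_ge0// NkE.
  rewrite -expRD natrX -/x.
  apply: (@le_trans _ _ (expR (- y) * expR (- x))).
    by rewrite -expRD ler_expR; lra.
  rewrite ler_wpM2l ?expR_ge0// expRN lef_pV2 ?posrE ?expR_gt0//.
  by rewrite (le_trans _ (expR_ge1Dx _))// lerDr.
exists (bad0 `|` \bigcup_k bad1 k).
  have mb1 : measurable (\bigcup_k bad1 k) by exact: bigcupT_measurable.
  split; first exact: measurableU.
  rewrite (_ : 4 * expR (- y) = 2 * expR (- y) + 2 * expR (- y)); last by ring.
  apply: (prob_le_add mbad0 mb1 _ (@subset_refl _ _) Pbad0); first exact: measurableU.
  apply: (@le_trans _ _ (\sum_(k <oo) P (bad1 k))%E).
    exact: measure_sigma_subadditive.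
  apply: (@le_trans _ _ (\sum_(k <oo) (2 * expR (- y) / (2 ^ k.+1)%:R)%:E)%E).
    by apply: lee_nneseries.
  by apply: (epsilon_trick0 xpredT); rewrite mulr_ge0 ?expR_ge0.
move=> w nb t Tt.
have [i [iN ip iG iD]] := chainT Tt.
have H0 : `|Z (p l (i l)) w| <= B * (2 `^ alpha^-1 * u * rT).
  have : ~ E (p l (i l)) 0 s0 w.
    move=> Ew; apply: nb; left; rewrite /bad0 -bigcup_seq.
    by exists (Ordinal (iN l)) => //=; rewrite mem_index_enum.
  move=> /negP; rewrite /E/= -leNgt Z0 !subr0 => h; rewrite (le_trans h)//.
  have -> : s0 = 2 `^ alpha^-1 * u.
    by rewrite /s0 powRM ?(ltW y0)// /y -powRrM mulfV ?gt_eqF// powRr1// ltW.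
  have -> : 2 `^ alpha^-1 * u * B * norm2 (p l (i l)) =
    B * (2 `^ alpha^-1 * u * norm2 (p l (i l))) by ring.
  rewrite ler_wpM2l// ler_wpM2l ?mulr_ge0 ?powR_ge0 ?(ltW u0)//.
  exact: Tr.
have H1 k : (l <= k)%N -> `|Z (p k.+1 (i k.+1)) w - Z (p k (i k)) w| <=
    B * 6 `^ alpha^-1 * (2 `^ (k%:R / alpha) * norm2 (p k.+1 (i k.+1) - p k (i k))).
  move=> lk; have : ~ E (p k.+1 (i k.+1)) (p k (par k (i k.+1))) (sk k) w.
    move=> Ew; apply: nb; right; exists k => //; rewrite /bad1 lk -bigcup_seq.
    by exists (Ordinal (iN k.+1)) => //=; rewrite mem_index_enum.
  rewrite ip => /negP; rewrite /E/= -leNgt => h; rewrite (le_trans h)//.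
  have -> : sk k = 6 `^ alpha^-1 * 2 `^ (k%:R / alpha).
    rewrite /sk powRrM powR_mulrn// -powRM ?exprn_ge0//.
    by congr (_ `^ _); rewrite exprS; ring.
  by rewrite le_eqVlt; apply/orP; left; apply/eqP; ring.
have H2 m : `|Z (p (l + m)%N (i (l + m)%N)) w| <= B * (2 `^ alpha^-1 * u * rT) +
    B * 6 `^ alpha^-1 * \sum_(k < l + m)
      2 `^ (k%:R / alpha) * norm2 (p k.+1 (i k.+1) - p k (i k)).
  elim: m => [|m IH].
    rewrite addn0 (le_trans H0)// lerDl mulr_ge0 ?mulr_ge0 ?powR_ge0//.
    by apply: sumr_ge0 => k _; rewrite mulr_ge0 ?powR_ge0 ?norm2_ge0.
  rewrite addnS big_ord_recr/= mulrDr addrA.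
  set z1 := Z _ w; set z0 := Z (p (l + m)%N _) w in IH *.
  have -> : z1 = z0 + (z1 - z0) by rewrite addrC subrK.
  by rewrite (le_trans (ler_normD _ _))// lerD// H1// leq_addr.
apply/ler_addgt0Pr => e e0.
have [k lk he] := chain_cvg w l e0 iD.
have -> : Z t w = Z (p k (i k)) w + (Z t w - Z (p k (i k)) w) by rewrite addrC subrK.
rewrite (le_trans (ler_normD _ _))// lerD//.
have := H2 (k - l)%N; rewrite subnKC// => /le_trans; apply.
rewrite mulrDr [leLHS]addrC lerD2r -mulrA ler_wpM2l// ler_wpM2l ?powR_ge0//.
Qed.

End Chaining.

(** * The deviation inequality *)

(* No measurability is assumed: [f] will be a supremum over an arbitrary set. *)
Lemma integral_le_nonneg d (Om : measurableType d) (R : realType)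
    (mu : {measure set Om -> \bar R}) (f g : Om -> \bar R) :
  (forall w, 0 <= f w)%E -> (forall w, f w <= g w)%E ->
  (\int[mu]_w f w <= \int[mu]_w g w)%E.
Proof.
move=> f0 fg; have g0 w : (0 <= g w)%E by exact: le_trans (fg w).
rewrite !ge0_integralTE//; apply: ereal_sup_le => _ [h hf <-].
by exists h => // w; exact: le_trans (fg w).
Qed.

Section Gamma.
Context {R : realType} {n : nat} (alpha : R) (T : set 'cV[R]_n).
Hypothesis T0 : T !=set0.

Lemma admissible0 F : admissible T F -> F 0%N T.
Proof.
move=> [pF _ F0 _]; have [cF _ _] := pF 0%N.
have [/pcard_leP[f] _] := (card_eqPle _ _).1 F0.
have uniqF S S' : F 0%N S -> F 0%N S' -> S = S'.
  move=> FS FS'; apply: ('inj_f); rewrite ?inE//.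
  have := 'funS_f FS; have := 'funS_f FS'.
  by rewrite /= !ltnS !leqn0 => /eqP -> /eqP ->.
have [t Tt] := T0; have [S FS St] : cover (F 0%N) id t by rewrite cF.
suff <- : S = T by [].
rewrite -cF; apply/seteqP; split => [x Sx|x [S' FS' S'x]]; first by exists S.
by rewrite (uniqF _ _ FS FS').
Qed.

Let terms (F : nat -> set (set 'cV[R]_n)) t k :=
  ((2 `^ (k%:R / alpha))%:E * diam (pblock (F k) id t))%E.

Lemma chain_terms_ge0 F t k : admissible T F -> T t -> (0 <= terms F t k)%E.
Proof.
move=> [pF _ _ _] Tt; rewrite /terms mule_ge0 ?lee_fin ?powR_ge0//.
exact: diam_ge0 (pblockP (pF k) Tt).2.
Qed.

(** The term of level 0 has weight 1 and its block is all of [T]. Hence [gamma] is nonnegative, and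
    all diameters vanish when it does. *)
Lemma diam_le_gamma : (diam T <= gamma alpha T)%E.
Proof.
apply: le_ereal_inf_tmp => _ [F aF <-]; have [t Tt] := T0.
apply: (@le_trans _ _ (\sum_(0 <= k <oo) terms F t k)%E); last first.
  by apply: ereal_sup_ubound; exists t.
apply: (@le_trans _ _ (\sum_(0 <= k < 1) terms F t k)%E); last first.
  by apply: nneseries_lim_ge => k _ _; exact: chain_terms_ge0.
rewrite big_nat1 /terms mul0r powRr0 mul1e.
have [pF _ _ _] := aF; rewrite (pblock_eq (pF 0%N) (admissible0 aF) Tt)//.
Qed.

Lemma gamma_ge0 : (0 <= gamma alpha T)%E.
Proof. by have [t Tt] := T0; apply: le_trans diam_le_gamma; exact: diam_ge0 Tt. Qed.

Lemma rad_ge0 : (0 <= rad T)%E.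
Proof.
have [t Tt] := T0; apply: (@le_trans _ _ (norm2 t)%:E); first by rewrite lee_fin norm2_ge0.
by apply: ereal_sup_ubound; exists t.
Qed.

(** For [g > 0] the factor 2 leaves room above the infimum. For [g = 0] it leaves none, but then [T]
    has diameter 0 and every admissible sequence has sum 0. *)
Lemma gamma_attained g : gamma alpha T = g%:E ->
  exists2 F, admissible T F & forall t, T t ->
    (\sum_(0 <= k <oo) (2 `^ (k%:R / alpha))%:E * diam (pblock (F k) id t)
      <= (2 * g)%:E)%E.
Proof.
move=> gE; have g0 : 0 <= g by rewrite -lee_fin -gE gamma_ge0.
have sup F t (b : \bar R) : T t ->
    (ereal_sup [set (\sum_(0 <= k <oo) terms F t k)%E | t in T] < b)%E ->
    (\sum_(0 <= k <oo) terms F t k <= b)%E.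
  by move=> Tt /ltW; apply: le_trans; apply: ereal_sup_ubound; exists t.
move: g0; rewrite le_eqVlt => /orP[/eqP g0|g0]; last first.
  have : (gamma alpha T < (2 * g)%:E)%E by rewrite gE lte_fin; lra.
  move=> /ereal_inf_lt[_ [F aF <-] Fg]; exists F => // t Tt.
  exact: sup Fg.
have : (gamma alpha T < +oo)%E by rewrite gE ltry.
move=> /ereal_inf_lt[_ [F aF _] _]; exists F => // t Tt.
rewrite eseries0 ?lee_fin -?g0 ?mulr0// => k _ _.
have [pF _ _ _] := aF; have [FB Bt] := pblockP (pF k) Tt.
suff -> : diam (pblock (F k) id t) = 0%E by rewrite mule0.
apply/eqP; rewrite eq_le (diam_ge0 Bt) andbT.
apply: le_trans (_ : diam T <= 0)%E; last first.
  by have := diam_le_gamma; rewrite gE -g0.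
apply: ereal_sup_le => _ [x Bx [y By <-]].
by exists x; [exact: (partition_sub (pF k) FB)|exists y => //; exact: (partition_sub (pF k) FB)].
Qed.

End Gamma.

(** With [x = 2 ^+ j], [expR (- x^alpha)] is at most a multiple of [x^-2], which survives
    multiplication by [x]. The bounds on the right sum to [E]. *)
Lemma geometric_tail (R : realType) (alpha : R) : 0 < alpha ->
  exists2 E : R, 0 < E & forall j : nat,
    2 ^+ j * (4 * expR (- ((2 ^+ j) `^ alpha))) <= E / (2 ^ j.+1)%:R.
Proof.
move=> a0; have [C C0 HC] := @powR_le_expR R (2 / alpha) (divr_gt0 (ltr0n _ 2) a0).
exists (8 * C) => [|j]; first by rewrite mulr_gt0.
set x : R := 2 ^+ j; have x0 : 0 < x by rewrite exprn_gt0.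
have h : x ^+ 2 <= C * expR (x `^ alpha).
  have := HC _ (powR_ge0 x alpha).
  rewrite -powRrM (_ : alpha * (2 / alpha) = 2%:R); last by field; rewrite gt_eqF.
  by rewrite powR_mulrn// ltW.
have -> : (2 ^ j.+1)%:R = 2 * x by rewrite natrX exprS.
rewrite expRN ler_pdivlMr ?mulr_gt0//.
rewrite (_ : _ * _ * _ = 8 * (x ^+ 2 / expR (x `^ alpha))); last by ring.
by rewrite ler_pM2l// ler_pdivrMr ?expR_gt0.
Qed.

Section Deviation.
Context (R : realType) (alpha : R).
Hypotheses (alpha_gt0 : 0 < alpha) (alpha_le2 : alpha <= 2).
Context d (Om : measurableType d) (P : probability Om R) (m n : nat).
Context (A : Om -> 'M[R]_(m, n)) (T : set 'cV[R]_n) (B g r : R).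
Hypothesis mA : random_matrix A.
Hypothesis T0 : T !=set0.
Hypothesis B0 : 0 < B.
Hypothesis tailA : forall (x y : 'cV[R]_n) (s : R), 0 <= s ->
  (P [set w | (s * B * norm2 (x - y) < `|dev (A w) x - dev (A w) y|)%R]
    <= (2 * expR (- (s `^ alpha)))%:E)%E.
Hypothesis gE : gamma alpha T = g%:E.
Hypothesis rE : rad T = r%:E.

(** The chaining constants for [G = 2 * g], the sum along an almost optimal sequence. *)
Let D : R := 2 * 6 `^ alpha^-1 + 2 `^ alpha^-1.

Lemma deviation_le w (c : R) :
  (deviation (A w) T <= c%:E)%E <-> forall t, T t -> `|dev (A w) t| <= c.
Proof.
split=> [h t Tt|h]; last first.
  by apply: ge_ereal_sup => _ [t Tt <-]; rewrite lee_fin; exact: h.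
by rewrite -lee_fin; apply: le_trans h; apply: ereal_sup_ubound; exists t.
Qed.

Lemma norm2_le_rad t : T t -> norm2 t <= r.
Proof. by move=> Tt; rewrite -lee_fin -rE; apply: ereal_sup_ubound; exists t. Qed.

Lemma deviation_tail :
  (forall c : R, measurable [set w | deviation (A w) T <= c%:E]%E) /\
  forall u, 1 <= u ->
    (P (~` [set w | deviation (A w) T <= (B * D * (g + u * r))%:E]%E)
      <= (4 * expR (- (u `^ alpha)))%:E)%E.
Proof.
have a0 := alpha_gt0.
have [F aF HF] := gamma_attained T0 gE.
have [p [par [pT chainT]]] := chain_of_admissible T0 aF HF.
have mdev x : measurable_fun setT (fun w => dev (A w) x) by exact: measurable_dev.
have lip w : exists2 l : R, 0 <= l &
    forall x y, `|dev (A w) x - dev (A w) y| <= l * norm2 (x - y).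
  exact: dev_lip.
have mS c : measurable [set w | deviation (A w) T <= c%:E]%E.
  rewrite (_ : [set w | _] = ~` \bigcup_k \bigcup_i [set w | c < `|dev (A w) (p k i)|]).
    apply: measurableC; apply: bigcupT_measurable => k; apply: bigcupT_measurable => i.
    by apply: measurable_gt; exact: measurableT_comp.
  apply/seteqP; split=> w /=.
    move=> /deviation_le h [k _ [i _]] /=; rewrite ltNge => /negP; apply.
    exact: h (pT k i).
  move=> h; apply/deviation_le.
  move=> t Tt; apply: (chain_dense (Z := fun x w => dev (A w) x)
    a0 alpha_le2 lip chainT _ Tt) => k i.
  by rewrite leNgt; apply/negP => ki; apply: h; exists k => //; exists i.
split=> // u u1.
have [bad [mbad Pbad] Hbad] := chaining_tail (Z := fun x w => dev (A w) x) a0 alpha_le2 lip chainT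
  mdev (fun w => dev0 (A w)) (ltW B0) tailA pT u1 norm2_le_rad.
apply: le_trans Pbad; apply: le_measure; rewrite ?inE//; first exact: measurableC.
move=> w /= nw; apply: contrapT => nb; apply: nw; apply/deviation_le => t Tt.
rewrite (le_trans (Hbad w nb t Tt))// -[leRHS]mulrA ler_wpM2l ?(ltW B0)//.
have g0 : 0 <= g by rewrite -lee_fin -gE; exact: gamma_ge0.
have r0 : 0 <= r by rewrite -lee_fin -rE; exact: rad_ge0.
have p6 : 0 <= 6 `^ alpha^-1 :> R by exact: powR_ge0.
have p2 : 0 <= 2 `^ alpha^-1 :> R by exact: powR_ge0.
have ur0 : 0 <= u * r by rewrite mulr_ge0// (le_trans _ u1).
rewrite /D mulrDl !mulrDr -!mulrA.
have := mulr_ge0 p2 g0; have := mulr_ge0 p6 ur0; lra.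
Qed.

(** Pointwise, the deviation is at most [c * (g + r)] plus the sum of [c * r * 2 ^+ j] over those
    [j] for which the level [c * (g + 2 ^+ j * r)] is exceeded; integrating this bound leaves a
    series of tail probabilities. *)
Lemma deviation_expectation (E : R) : 0 < E ->
  (forall j : nat, 2 ^+ j * (4 * expR (- ((2 ^+ j) `^ alpha))) <= E / (2 ^ j.+1)%:R) ->
  (\int[P]_w deviation (A w) T <= (B * D * (1 + E) * (g + r))%:E)%E.
Proof.
move=> E0 HE; have [mS tail] := deviation_tail.
have D0 : 0 < D by rewrite /D addr_gt0 ?mulr_gt0 ?powR_gt0.
have g0 : 0 <= g by rewrite -lee_fin -gE; exact: gamma_ge0.
have r0 : 0 <= r by rewrite -lee_fin -rE; exact: rad_ge0.
have [c [c0 cE]] : exists c : R, 0 < c /\ c = B * D.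
  by eexists; split; [|reflexivity]; rewrite mulr_gt0.
rewrite -cE in tail *.
pose bad j := ~` [set w | deviation (A w) T <= (c * (g + 2 ^+ j * r))%:E]%E.
have mbad j : measurable (bad j) by apply: measurableC; exact: mS.
pose f j w := (c * r * 2 ^+ j * \1_(bad j) w)%:E.
have f0 j w : (0 <= f j w)%E.
  by rewrite lee_fin !mulr_ge0// ?exprn_ge0// ltW.
have mf j : measurable_fun setT (f j).
  by apply/measurable_EFinP; apply: measurable_funM => //; exact: measurable_indic.
(* Exceeding level [J] means exceeding all lower levels, and the geometric sum [2 ^+ J.+1 - 1] then
   restores exactly the level [J.+1]. *)
have ub w J : (deviation (A w) T <= (c * (g + 2 ^+ J * r))%:E)%E ->
    (deviation (A w) T <= (c * (g + r))%:E + \sum_(0 <= j < J) f j w)%E.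
  elim: J => [|J IH]; first by rewrite expr0 mul1r big_geq// adde0.
  have [/IH h _|nh h] := pselect (deviation (A w) T <= (c * (g + 2 ^+ J * r))%:E)%E.
    by rewrite big_nat_recr//= addeA (le_trans h)// leeDl.
  have nbad j : (j <= J)%N -> bad j w.
    move=> jJ hj; apply: nh; apply: (le_trans hj); rewrite lee_fin ler_pM2l// lerD2l.
    by rewrite ler_wpM2r// ler_weXn2l// ler1n.
  apply: (le_trans h); rewrite (eq_big_nat _ _ (F2 := fun j => (c * r * 2 ^+ j)%:E)); last first.
    move=> j /andP[_ jJ]; rewrite /f indicE mem_set ?mulr1//; exact: nbad.
  have geo : \sum_(0 <= j < J.+1) 2 ^+ j = 2 ^+ J.+1 - 1 :> R.
    rewrite big_mkord subrX1 (_ : 2 - 1 = 1 :> R) ?mul1r//; ring.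
  rewrite sumEFin -EFinD lee_fin -mulr_sumr geo.
  by rewrite le_eqVlt; apply/orP; left; apply/eqP; ring.
(* The Lipschitz constant of the realization supplies a [J], depending on [w], at which the finite
   bound applies. *)
have ub' w : (deviation (A w) T <= (c * (g + r))%:E + \sum_(0 <= j <oo) f j w)%E.
  have [l l0 Hl] := dev_lip (A w).
  pose J := Num.bound (l / c).
  have lc0 : 0 <= l / c by rewrite divr_ge0// ltW.
  have lJ : l <= c * 2 ^+ J.
    rewrite mulrC -ler_pdivrMr// (le_trans (ltW (archi_boundP lc0)))//.
    by rewrite -natrX ler_nat ltnW// ltn_expl.
  apply: (le_trans (ub w J _)); last by rewrite leeD2l// nneseries_lim_ge.
  apply/deviation_le => t Tt; have := Hl t 0; rewrite dev0 !subr0 => /le_trans; apply.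
  apply: (@le_trans _ _ (c * 2 ^+ J * r)).
    by rewrite ler_pM ?norm2_ge0// norm2_le_rad.
  by rewrite mulrDr mulrA lerDr mulr_ge0// ltW.
have Pbad j : (P (bad j) <= (4 * expR (- ((2 ^+ j) `^ alpha)))%:E)%E.
  by apply: tail; rewrite exprn_ege1// ler1n.
have intf j : (\int[P]_w f j w <= (c * r * E / (2 ^ j.+1)%:R)%:E)%E.
  have k0 : 0 <= c * r * 2 ^+ j by rewrite !mulr_ge0 ?exprn_ge0// ltW.
  rewrite /f; under eq_integral do rewrite EFinM.
  rewrite ge0_integralZl_EFin//; last first.
    by apply/measurable_EFinP; exact: measurable_indic.
  rewrite integral_indic// setIT (le_trans (lee_wpmul2l _ (Pbad j))) ?lee_fin//.
  by rewrite -!mulrA ler_wpM2l ?(ltW c0)// ler_wpM2l.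
have a0 : 0 <= c * (g + r) by rewrite mulr_ge0 ?addr_ge0// ltW.
have mf' : measurable_fun setT (fun w => \sum_(0 <= j <oo) f j w)%E.
  by apply: ge0_emeasurable_sum => // j w _ _; exact: f0.
apply: (@le_trans _ _ (\int[P]_w ((c * (g + r))%:E + \sum_(0 <= j <oo) f j w))%E).
  apply: integral_le_nonneg => // w.
  have [t Tt] := T0; apply: (@le_trans _ _ (`|dev (A w) t|)%:E).
    by rewrite lee_fin.
  by apply: ereal_sup_ubound; exists t.
rewrite ge0_integralD//; last by move=> w _; apply: nneseries_ge0.
rewrite integral_nneseries//.
have -> : (\int[P]_w (c * (g + r))%:E = (c * (g + r))%:E)%E.
  by rewrite -[RHS]mule1 -(probability_setT P) -integral_cst.
apply: (@le_trans _ _ ((c * (g + r))%:E + (c * r * E)%:E)%E).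
  rewrite leeD2l//.
  apply: (@le_trans _ _ (\sum_(j <oo) (c * r * E / (2 ^ j.+1)%:R)%:E)%E).
    by apply: lee_nneseries => // j _ _; apply: integral_ge0 => w _.
  by apply: (epsilon_trick0 xpredT); rewrite !mulr_ge0// ltW.
rewrite -EFinD lee_fin.
have : 0 <= c * E * g by rewrite !mulr_ge0// ltW.
lra.
Qed.

End Deviation.

Theorem corollary1p1 (R : realType) :
  exists2 C : R, 0 < C &
  forall alpha : R, 0 < alpha -> alpha <= 2 ->
  exists2 Calpha : R, 0 < Calpha &
  forall (d : measure_display) (Om : measurableType d) (P : probability Om R)
    (m n : nat) (A : Om -> 'M[R]_(m, n)) (K : R) (T : set 'cV[R]_n),
    random_matrix A ->
    zero_mean P A ->
    independent_vectors P (matrix_row A) ->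
    (forall i, isotropic P (matrix_row A i)) ->
    (forall i, (psi_norm_vec P alpha (matrix_row A i) <= K%:E)%E) ->
    bounded_set T ->
    (\int[P]_w deviation (A w) T
       <= (Calpha * K `^ (4 / alpha))%:E * (gamma alpha T + rad T))%E /\
    (forall u : R, 0 <= u ->
       ((1 - C * expR (- (u `^ alpha)))%:E
         <= P [set w | deviation (A w) T
                  <= (Calpha * K `^ (4 / alpha))%:E
                       * (gamma alpha T + u%:E * rad T)])%E).
Proof.
(* The 4 is the prefactor of the chaining tail; [expR 1] makes the claimed probability bound
   nonpositive for [u < 1], below the range of the chaining. *)
exists (4 * expR 1) => [|alpha a0 a2]; first by rewrite mulr_gt0 ?expR_gt0.
have [B0 B00 HB] := dev_subgaussian a0 a2.
have [E E0 HE] := geometric_tail a0.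
pose D : R := 2 * 6 `^ alpha^-1 + 2 `^ alpha^-1.
have D0 : 0 < D by rewrite /D addr_gt0 ?mulr_gt0 ?powR_gt0.
(* [B0] scales the increments, [D] comes from chaining and [1 + E] from integrating the tail. *)
exists (B0 * D * (1 + E)) => [|d Om P m n A K T mA _ ind iso psi _].
  by rewrite !mulr_gt0// addr_gt0.
have [K0 tailA] := HB _ _ P _ _ A K mA ind iso psi.
have k0 : 0 <= K `^ (4 / alpha) by exact: powR_ge0.
set k := K `^ _ in K0 tailA k0 *.
have c0 : 0 <= B0 * D * (1 + E) * k by rewrite !mulr_ge0 ?addr_ge0// ltW.
have Cge u : 0 <= u -> u < 1 -> ((1 - 4 * expR 1 * expR (- (u `^ alpha)))%:E <= 0)%E.
  move=> u0 u1; rewrite lee_fin subr_le0 -mulrA -expRD.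
  have : u `^ alpha <= 1.
    have <- : 1 `^ alpha = 1 :> R by rewrite powR1.
    by rewrite ge0_ler_powR ?(ltW a0) ?nnegrE ?(ltW u1).
  move=> ua; have := expR_ge1Dx (1 - u `^ alpha); lra.
have full (S : set Om) u : S = setT ->
    ((1 - 4 * expR 1 * expR (- (u `^ alpha)))%:E <= P S)%E.
  move=> ->; rewrite probability_setT lee_fin gerBl !mulr_ge0 ?expR_ge0//.
(* On the empty set the deviation is [-oo], below any right-hand side. *)
have [T0|/set0P T0] := eqVneq T set0.
  have V w : deviation (A w) T = -oo%E.
    by rewrite /deviation T0 image_set0 ereal_sup0.
  split.
    under eq_integral do rewrite V.
    by rewrite (integral_cst P measurableT -oo%E)/= probability_setT mule1 leNye.
  move=> u u0; apply: full; apply/seteqP; split => // w _ /=.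
  by rewrite V leNye.
have g0 := gamma_ge0 alpha T0; have r0 := rad_ge0 T0.
have ur0 u : 0 <= u -> (0 <= u%:E * rad T)%E by move=> u0; rewrite mule_ge0.
case: K0 => [K0|V0]; last first.
  have V w : deviation (A w) T = 0%E.
    apply/eqP; rewrite eq_le; apply/andP; split.
      by apply: ge_ereal_sup => _ [t _ <-]; rewrite -/(dev (A w) t) V0 normr0.
    have [t Tt] := T0; apply: ereal_sup_ubound; exists t => //.
    by rewrite -/(dev (A w) t) V0 normr0.
  split.
    under eq_integral do rewrite V.
    by rewrite integral0 mule_ge0 ?lee_fin// adde_ge0.
  move=> u u0; apply: full; apply/seteqP; split => // w _ /=.
  by rewrite V mule_ge0 ?lee_fin// adde_ge0// ur0.
have c1 : 0 < B0 * D * (1 + E) * k by rewrite !mulr_gt0// addr_gt0.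
case gE : (gamma alpha T) g0 => [g||//] g0; last first.
  split.
    rewrite addye ?gt0_muley ?lte_fin ?leey//.
    by rewrite gt_eqF// (lt_le_trans _ r0).
  move=> u u0; apply: full; apply/seteqP; split => // w _ /=.
  rewrite addye ?gt0_muley ?lte_fin ?leey//.
  by rewrite gt_eqF// (lt_le_trans _ (ur0 u u0)).
case rE : (rad T) r0 => [r||//] r0; last first.
  split; first by rewrite addey ?gt0_muley ?lte_fin ?leey.
  (* As [0 * +oo] is 0, an infinite radius makes the right-hand side infinite only for [u > 0];
     small [u] are left to [Cge]. *)
  move=> u u0; have [u1|u1] := ltP u 1.
    by rewrite (le_trans (Cge u u0 u1)).
  apply: full; apply/seteqP; split => // w _ /=.
  have u1' : (0 < u%:E)%E by rewrite lte_fin (lt_le_trans _ u1).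
  by rewrite gt0_muley// addey ?gt0_muley ?lte_fin ?leey.
have kB : 0 < B0 * k by rewrite mulr_gt0.
split.
  apply: le_trans (deviation_expectation a0 a2 mA T0 kB tailA gE rE E0 HE) _.
  by rewrite -EFinD -EFinM lee_fin le_eqVlt; apply/orP; left; apply/eqP; rewrite /D; ring.
move=> u u0; have [u1|u1] := ltP u 1.
  by rewrite (le_trans (Cge u u0 u1)).
have [mS tail] := deviation_tail a0 a2 mA T0 kB tailA gE rE.
have -> : ((B0 * D * (1 + E) * k)%:E * (g%:E + u%:E * r%:E) =
    (B0 * D * (1 + E) * k * (g + u * r))%:E)%E by [].
pose S' := [set w | (deviation (A w) T <= (B0 * k * D * (g + u * r))%:E)%E].
apply: (@le_trans _ _ (P S')).
  rewrite -[S']setCK probability_setC; last by apply: measurableC; exact: mS.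
  rewrite EFinB leeB// (le_trans (tail u u1))// lee_fin ler_wpM2r ?expR_ge0//.
  by rewrite ler_peMr// (le_trans _ (expR_ge1Dx _))// lerDl.
apply: le_measure; rewrite ?inE//; first exact: mS.
move=> w /= /le_trans; apply; rewrite lee_fin.
have h : 0 <= B0 * k * D * (g + u * r).
  rewrite !mulr_ge0// ?(ltW B00) ?(ltW D0)// addr_ge0 ?mulr_ge0//.
have := mulr_ge0 (ltW E0) h; lra.
Qed.
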